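(* Let $\Gamma$ be a strongly connected digraphon on an atomless probability space $(\Omega,\mu)$, and let $D$ be the peripheral multiplicity of $\Gamma$. (i) Suppose that $\Gamma$ is graphically $d$-periodic for some $d\in\mathbb{N}$. Then the number $\exp(-2\pi\mathbf{i}/d)\,\rho(\Gamma)$ is an eigenvalue of $\Gamma$. In particular, $d$ divides $D$. (ii) The digraphon $\Gamma$ is graphically $D$-periodic. Furthermore, there exists a partition $\Omega=P_0\sqcup P_1\sqcup\ldots\sqcup P_{D-1}$ into cyclic sets (witnessing graphical $D$-periodicity) such that for every $i,j\in\{0,1,\ldots,D-1\}$ and almost every pair $(x,y)\in P_i\times P_j$, the reachability sequence from $x$ to $y$ is eventually $D$-periodic with shift $j-i$.
   Context: $\mathbb{N}=\{1,2,\ldots\}$; $\mathbf{i}$ is the imaginary unit. All subsets of $\Omega$ are measurable. A digraphon on $(\Omega,\mu)$ is a measurable function $\Gamma:\Omega^2\to[0,1]$. It is strongly connected if $\int_{A\times B}\Gamma>0$ for every partition $A\sqcup B=\Omega$ with $\mu(A),\mu(B)>0$. $\Gamma$ induces the compact operator $T_\Gamma$ on complex $L^2(\Omega)$, $(T_\Gamma f)(x)=\int_\Omega f(y)\Gamma(y,x)\,d\mu(y)$; eigenvalues of $\Gamma$ are those of $T_\Gamma$. The spectral radius $\rho(\Gamma)$ is the supremum of the moduli of the eigenvalues ($0$ if there are none). An eigenvalue is peripheral if its modulus equals $\rho(\Gamma)$. The peripheral multiplicity of $\Gamma$ is the number of peripheral eigenvalues. For $d\in\mathbb{N}$, $\Gamma$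 is graphically $d$-periodic if there is a partition $\Omega=P_0\sqcup\ldots\sqcup P_{d-1}$ such that (with $P_d=P_0$) for every $j=0,\ldots,d-1$, $\Gamma=0$ almost everywhere on $P_j\times(\Omega\setminus P_{j+1})$. The sets $P_j$ are called cyclic sets. Powers of $\Gamma$: $\Gamma^1=\Gamma$ and $\Gamma^k(x,y)=\int_{\Omega^{k-1}}\Gamma(x,x_2)\Gamma(x_2,x_3)\cdots\Gamma(x_k,y)\,d\mu^{k-1}(x_2,\ldots,x_k)$. The reachability sequence from $x$ to $y$ is the set $\{k\in\mathbb{N}:\Gamma^k(x,y)>0\}$. A set $S\subseteq\mathbb{N}$ is eventually $D$-periodic with shift $s\in\mathbb{Z}$ if $S-s\subseteq D\mathbb{Z}$ and for some $k\in\mathbb{N}$ we have $(S-s)\cap\{k,k+1,\ldots\}=D\mathbb{N}\cap\{k,k+1,\ldots\}$. *)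

(* Defs.v *)
From HB Require Import structures.
From mathcomp Require Import all_boot all_order all_algebra.
From mathcomp Require Import finmap.
From mathcomp Require Import all_classical all_reals all_analysis.
From mathcomp Require Import complex.

Set Implicit Arguments.
Unset Strict Implicit.
Unset Printing Implicit Defensive.

Import Order.TTheory GRing.Theory Num.Theory.
Import numFieldNormedType.Exports.

Local Open Scope classical_set_scope.
Local Open Scope ring_scope.

Definition atomless d (T : measurableType d) (R : realType)
    (mu : {measure set T -> \bar R}) : Prop :=
  forall A : set T, measurable A -> (0 < mu A)%E ->
    exists B : set T, [/\ measurable B, B `<=` A & (0 < mu B < mu A)%E].

Record digraphon d (T : measurableType d) (R : realType) := Digraphon {
  digraphon_fun :> T * T -> R;
  digraphon_measurable : measurable_fun [set: T * T] digraphon_fun;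
  digraphon_bounds : forall z : T * T, 0 <= digraphon_fun z <= 1 }.

Definition strongly_connected d (T : measurableType d) (R : realType)
    (mu : probability T R) (G : digraphon T R) : Prop :=
  forall A B : set T, measurable A -> measurable B ->
    A `|` B = [set: T] -> A `&` B = set0 ->
    (0 < mu A)%E -> (0 < mu B)%E ->
    (0 < \int[mu \x mu]_(z in A `*` B) (G z)%:E)%E.

Definition cintegral d (T : measurableType d) (R : realType)
    (mu : {measure set T -> \bar R}) (f : T -> R[i]) : R[i] :=
  Complex (\int[mu]_x complex.Re (f x)) (\int[mu]_x complex.Im (f x)).

(* Representatives of the elements of complex L^2; equality in L^2 is equality
   almost everywhere. *)
Definition cL2 d (T : measurableType d) (R : realType)
    (mu : {measure set T -> \bar R}) (f : T -> R[i]) : Prop :=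
  (fun x => complex.Re (f x)) \in Lfun mu 2%:E /\
  (fun x => complex.Im (f x)) \in Lfun mu 2%:E.

(* The kernel is G(y, x), not G(x, y). *)
Definition digraphon_op d (T : measurableType d) (R : realType)
    (mu : probability T R) (G : digraphon T R) (f : T -> R[i]) (x : T) : R[i] :=
  cintegral mu (fun y => f y * (G (y, x))%:C%C).

Definition is_eigenvalue d (T : measurableType d) (R : realType)
    (mu : probability T R) (G : digraphon T R) (l : R[i]) : Prop :=
  exists f : T -> R[i],
    [/\ cL2 mu f,
        ~ {ae mu, forall x, f x = 0} &
        {ae mu, forall x, digraphon_op mu G f x = l * f x}].

(* [sup set0 = 0], and all eigenvalues have modulus at most 1. *)
Definition spectral_radius d (T : measurableType d) (R : realType)
    (mu : probability T R) (G : digraphon T R) : R :=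
  sup [set Normc.normc l | l in is_eigenvalue mu G].

Definition peripheral_eigenvalues d (T : measurableType d) (R : realType)
    (mu : probability T R) (G : digraphon T R) : set R[i] :=
  [set l | is_eigenvalue mu G l /\ Normc.normc l = spectral_radius mu G].

(* This is 0 if there are infinitely many peripheral eigenvalues. *)
Definition peripheral_multiplicity d (T : measurableType d) (R : realType)
    (mu : probability T R) (G : digraphon T R) : nat :=
  (#|` fset_set (peripheral_eigenvalues mu G)|)%fset.

Definition cyclic_sets d (T : measurableType d) (R : realType)
    (mu : probability T R) (G : digraphon T R) (n : nat)
    (P : 'I_n -> set T) : Prop :=
  [/\ forall j, measurable (P j),
      partition [set: 'I_n] P [set: T] &
      forall j, {ae (mu \x mu)%E, forall z : T * T,
        (P j `*` ~` P (ordS j)) z -> G z = 0}].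

Definition graphically_periodic d (T : measurableType d) (R : realType)
    (mu : probability T R) (G : digraphon T R) (n : nat) : Prop :=
  (0 < n)%N /\ exists P : 'I_n -> set T, cyclic_sets mu G P.

Definition tuple_cons d (T : measurableType d) (n : nat) (z : T * n.-tuple T) :
  n.+1.-tuple T := [tuple of z.1 :: z.2].

Lemma measurable_tuple_cons d (T : measurableType d) (n : nat) :
  measurable_fun [set: T * n.-tuple T] (@tuple_cons d T n).
Proof.
by apply: measurable_cons; [exact: measurable_fst|exact: measurable_snd].
Qed.

HB.instance Definition _ d (T : measurableType d) (n : nat) :=
  isMeasurableFun.Build _ _ _ _ (@tuple_cons d T n)
    (@measurable_tuple_cons d T n).

(* The product measure mu^n on n.-tuple T: mu^0 is the point mass at the empty
   tuple, and mu^(n+1) is the image of mu \x mu^n under [tuple_cons]. *)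
Fixpoint power_measure d (T : measurableType d) (R : realType)
    (mu : probability T R) (n : nat) : probability (n.-tuple T) R :=
  match n with
  | 0 => \d_[tuple]
  | m.+1 => distribution (mu \x power_measure mu m)%E (@tuple_cons d T m)
  end.

(* The intended range is 1 <= k; the integrand is the product of G over the
   consecutive pairs of x, x_2, ..., x_k, y. *)
Definition digraphon_power d (T : measurableType d) (R : realType)
    (mu : probability T R) (G : digraphon T R) (k : nat) (x y : T) : R :=
  \int[power_measure mu k.-1]_s
    \prod_(i < k) G (nth x (x :: s) i, nth y (rcons s y) i).

Definition reachability_sequence d (T : measurableType d) (R : realType)
    (mu : probability T R) (G : digraphon T R) (x y : T) : set nat :=
  [set k | (0 < k)%N /\ 0 < digraphon_power mu G k x y].

Definition eventually_periodic (S : set nat) (D : nat) (s : int) : Prop :=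
  let S' : set int := [set n%:Z - s | n in S] in
  S' `<=` [set D%:Z * q | q in [set: int]] /\
  exists2 k : nat, (0 < k)%N &
    S' `&` [set n : int | k%:Z <= n] =
    [set D%:Z * q%:Z | q in [set q : nat | (0 < q)%N]] `&`
      [set n : int | k%:Z <= n].

Definition cexp (R : realType) (z : R[i]) : R[i] :=
  (expR (complex.Re z))%:C%C *
    Complex (cos (complex.Im z)) (sin (complex.Im z)).

(* Main.v *)
From HB Require Import structures.
Require Import Defs.
From mathcomp Require Import all_boot all_order all_algebra.
From mathcomp Require Import finmap.
From mathcomp Require Import all_classical all_reals all_analysis.
From mathcomp Require Import measurable_realfun complex ring lra zify.

(** A left Perron eigenfunction [f] is obtained without compactness of the operator [T]. Let
    [a n] be the integral of [T^n 1] and let [1 / w] be the growth rate of [a]. Since the kernel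
    is at most 1, the truncated resolvents [sum_(n < N) w^n T^n 1], normalized to have integral 1,
    are uniformly bounded. Along an ultrafilter they converge weakly to a probability [nu], and
    [x |-> w * int G(y, x) dnu(y)] is an eigenfunction. That the growth rate is positive follows
    from a set [A] of positive measure such that [G^n > 0] almost everywhere on [A x A]: there,
    [min(G^n(x, y), G^n(y, x))] is a symmetric kernel, and its iterates decay at most
    geometrically.

    The numbers [n] such that [G^n > 0] almost everywhere on [A x A] form a semigroup, which
    contains all large multiples of its greatest common divisor [p]. Sorting the points by the
    length modulo [p] of the walks from [A] yields [p] cyclic sets, and the reachability
    sequences are eventually [p]-periodic.

    If [g] is an eigenfunction of modulus [rho], equality in the triangle inequality shows that
    the phase of [g] is multiplied by [theta = lambda / rho] along almost every edge, whence
    [theta^p = 1] because two generic points are joined by walks of lengths [k] and [k + p].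
    Conversely, twisting [f] by powers of a root of unity along cyclic sets produces
    eigenfunctions. Hence the peripheral eigenvalues are the [p] numbers [rho * theta] with
    [theta^p = 1]. *)

Set Implicit Arguments.
Unset Strict Implicit.
Unset Printing Implicit Defensive.

Import Order.TTheory GRing.Theory Num.Theory.
Import numFieldNormedType.Exports.

Local Open Scope classical_set_scope.
Local Open Scope ring_scope.

(** * Bounded measurable functions *)

(** Since [G] is at most 1, the operator sends integrable functions to bounded ones. An
    eigenfunction in $L^2$ for a nonzero eigenvalue therefore has a bounded representative, and
    nearly all integrals below are of bounded functions over finite measures, where Fubini's theorem
    asks for no further integrability. The recurring obstacle is null sets. Two walks cannot be
    joined at one prescribed point; they are joined at a set of positive measure of midpoints, and
    most facts hold for almost every [x] and then almost every [y]. The two quantifiers are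
    exchanged by [ae_swap], which is why so many sets are shown to be measurable. That the Perron
    eigenvalue [r] dominates the moduli of all eigenvalues is not visible from the left
    eigenfunction alone. A right Perron eigenfunction [h > 0], obtained from the transposed
    digraphon, settles it: for an eigenfunction [g] of [l], integrating [|l| |g| <= T |g|] against
    [h] gives [|l| <= r], and equality forces [T |g| = r |g|] almost everywhere, which is the
    starting point of the argument on phases. *)

Definition bmf d (T : measurableType d) (R : realType) (f : T -> R) :=
  measurable_fun [set: T] f /\ exists M, forall x, `|f x| <= M.

Section bmf_closure.
Context d (T : measurableType d) (R : realType).
Implicit Types f g : T -> R.

Lemma bmf_cst (c : R) : bmf (fun _ : T => c).
Proof. by split=> //; exists `|c|. Qed.

Lemma bmfD f g : bmf f -> bmf g -> bmf (fun x => f x + g x).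
Proof.
move=> [mf [M fM]] [mg [N gN]]; split; first exact: measurable_funD.
by exists (M + N) => x; rewrite (le_trans (ler_normD _ _))// lerD.
Qed.

Lemma bmfM f g : bmf f -> bmf g -> bmf (fun x => f x * g x).
Proof.
move=> [mf [M fM]] [mg [N gN]]; split; first exact: measurable_funM.
by exists (M * N) => x; rewrite normrM ler_pM.
Qed.

Lemma bmfZ (c : R) f : bmf f -> bmf (fun x => c * f x).
Proof. by move=> bf; apply: bmfM => //; exact: bmf_cst. Qed.

Lemma bmfB f g : bmf f -> bmf g -> bmf (fun x => f x - g x).
Proof.
move=> bf bg; apply: bmfD => //.
have -> : (fun x => - g x) = (fun x => -1 * g x) by apply/funext => x; rewrite mulN1r.
exact: bmfZ.
Qed.

Lemma bmf_min f g : bmf f -> bmf g -> bmf (fun x => Num.min (f x) (g x)).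
Proof.
move=> [mf [M fM]] [mg [N gN]]; split; first exact: measurable_minr.
exists (M + N) => x; have := fM x; have := gN x.
have := normr_ge0 (f x); have := normr_ge0 (g x).
by case: (leP (f x) (g x)) => _ *; lra.
Qed.

Lemma bmf_indic (A : set T) : measurable A -> bmf (\1_A : T -> R).
Proof.
move=> mA; split; first exact: measurable_indic.
by exists 1 => x; rewrite indicE; case: (_ \in _); rewrite ?normr0 ?normr1.
Qed.

Lemma bmf_comp d' (T' : measurableType d') (h : T' -> T) f :
  measurable_fun setT h -> bmf f -> bmf (fun x => f (h x)).
Proof.
move=> mh [mf [M fM]]; split; first exact: (measurableT_comp mf mh).
by exists M.
Qed.

Lemma bmf_measurable f : bmf f -> measurable_fun setT f. Proof. by case. Qed.

Lemma bmf01 f : measurable_fun setT f -> (forall x, 0 <= f x <= 1) -> bmf f.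
Proof.
by move=> mf f01; split => //; exists 1 => x; have /andP[? ?] := f01 x; rewrite ger0_norm.
Qed.

Lemma bmf_sum n (f : nat -> T -> R) : (forall i, bmf (f i)) ->
  bmf (fun x => \sum_(i < n) f i x).
Proof.
move=> bf; elim: n => [|n IH].
  by under eq_fun do rewrite big_ord0; exact: bmf_cst.
by under eq_fun do rewrite big_ord_recr; exact: bmfD.
Qed.

Lemma measurable_pos_set f : measurable_fun setT f -> measurable [set x | 0 < f x].
Proof.
move=> mf; have := mf measurableT `]0, +oo[%classic (measurable_itv _).
by rewrite setTI; congr measurable; apply/seteqP; split => x /=; rewrite in_itv/= andbT.
Qed.

End bmf_closure.

Lemma bmf_pair d1 d2 (T1 : measurableType d1) (T2 : measurableType d2) (R : realType)
  (F : T1 * T2 -> R) x : bmf F -> bmf (fun y => F (x, y)).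
Proof. by apply: bmf_comp; exact: pair1_measurable. Qed.

Lemma bmf_pair2 d1 d2 (T1 : measurableType d1) (T2 : measurableType d2) (R : realType)
  (F : T1 * T2 -> R) y : bmf F -> bmf (fun x => F (x, y)).
Proof. by apply: bmf_comp; exact: pair2_measurable. Qed.

Lemma bmf_fst d1 d2 (T1 : measurableType d1) (T2 : measurableType d2) (R : realType)
  (f : T1 -> R) : bmf f -> bmf (fun z : T1 * T2 => f z.1).
Proof. by apply: bmf_comp; exact: measurable_fst. Qed.

Lemma bmf_snd d1 d2 (T1 : measurableType d1) (T2 : measurableType d2) (R : realType)
  (f : T2 -> R) : bmf f -> bmf (fun z : T1 * T2 => f z.2).
Proof. by apply: bmf_comp; exact: measurable_snd. Qed.

Section Rintegral_bmf.
Context d (T : measurableType d) (R : realType).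
Variable mu : {finite_measure set T -> \bar R}.
Implicit Types f g : T -> R.

Lemma bmf_integrable f : bmf f -> mu.-integrable setT (EFin \o f).
Proof.
move=> [mf [M fM]]; apply: (@measurable_bounded_integrable _ _ _ mu) => //.
- exact: fin_num_fun_lty.
- exists M; split; first by rewrite num_real.
  by move=> y My x _ /=; rewrite (le_trans (fM x))// ltW.
Qed.

Lemma RintD f g : bmf f -> bmf g ->
  \int[mu]_x (f x + g x) = \int[mu]_x f x + \int[mu]_x g x.
Proof. by move=> bf bg; rewrite RintegralD//; exact: bmf_integrable. Qed.

Lemma RintB f g : bmf f -> bmf g ->
  \int[mu]_x (f x - g x) = \int[mu]_x f x - \int[mu]_x g x.
Proof. by move=> bf bg; rewrite RintegralB//; exact: bmf_integrable. Qed.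

Lemma RintZ c f : bmf f -> \int[mu]_x (c * f x) = c * \int[mu]_x f x.
Proof. by move=> bf; rewrite RintegralZl//; exact: bmf_integrable. Qed.

Lemma RintZr c f : bmf f -> \int[mu]_x (f x * c) = \int[mu]_x f x * c.
Proof. by move=> bf; rewrite RintegralZr//; exact: bmf_integrable. Qed.

Lemma le_Rint f g : bmf f -> bmf g -> (forall x, f x <= g x) ->
  \int[mu]_x f x <= \int[mu]_x g x.
Proof. by move=> bf bg fg; apply: le_Rintegral => //; exact: bmf_integrable. Qed.

Lemma eq_Rint f g : (forall x, f x = g x) -> \int[mu]_x f x = \int[mu]_x g x.
Proof. by move=> fg; apply: eq_Rintegral => x _. Qed.

Lemma Rint_sum n (f : nat -> T -> R) : (forall i, bmf (f i)) ->
  \int[mu]_x (\sum_(i < n) f i x) = \sum_(i < n) \int[mu]_x f i x.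
Proof.
move=> bf; elim: n => [|n IH].
  by under eq_Rint do rewrite big_ord0; rewrite Rintegral_cst// mul0r big_ord0.
under eq_Rint do rewrite big_ord_recr/=.
by rewrite RintD ?IH ?big_ord_recr//; exact: bmf_sum.
Qed.

Lemma Rint_indic (A : set T) : measurable A -> \int[mu]_x (\1_A x) = fine (mu A).
Proof. by move=> mA; rewrite /Rintegral integral_indic// setIT. Qed.

Lemma Rint_EFin f : bmf f -> (\int[mu]_x (f x)%:E)%E = (\int[mu]_x f x)%:E.
Proof.
by move=> bf; rewrite fineK//; apply: integrable_fin_num => //; exact: bmf_integrable.
Qed.

Lemma Rint_eq0P f : bmf f -> (forall x, 0 <= f x) ->
  (\int[mu]_x f x = 0) <-> {ae mu, forall x, f x = 0}.
Proof.
move=> bf f0; have [mf _] := bf.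
have -> : (\int[mu]_x f x = 0) <-> (\int[mu]_x (`|(f x)%:E|) = 0)%E.
  under eq_integral do rewrite gee0_abs ?lee_fin//.
  by rewrite Rint_EFin//; split => [->|[]].
apply: (iff_trans (ae_eq_integral_abs mu measurableT _)); first exact/measurable_EFinP.
split; apply: filterS => x; first by move=> /(_ I) [].
by move=> ->.
Qed.

Lemma ae_eq_Rint f g : measurable_fun setT f -> measurable_fun setT g ->
  {ae mu, forall x, f x = g x} -> \int[mu]_x f x = \int[mu]_x g x.
Proof.
move=> mf mg fg; rewrite /Rintegral; congr fine; apply: ae_eq_integral => //.
- exact/measurable_EFinP.
- exact/measurable_EFinP.
- by apply: filterS fg => x -> _.
Qed.

Lemma Rint_gt0P f : bmf f -> (forall x, 0 <= f x) ->
  (0 < \int[mu]_x f x) <-> ~ {ae mu, forall x, f x = 0}.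
Proof.
move=> bf f0; rewrite -Rint_eq0P// lt_neqAle Rintegral_ge0// andbT eq_sym.
by split => [/eqP|] // /eqP.
Qed.

End Rintegral_bmf.

Section fubini_bmf.
Context d1 d2 (T1 : measurableType d1) (T2 : measurableType d2) (R : realType).
Variables (m1 : {finite_measure set T1 -> \bar R}) (m2 : {finite_measure set T2 -> \bar R}).
Implicit Types F : T1 * T2 -> R.


Lemma measurable_Rint_ge0 F : bmf F -> (forall z, 0 <= F z) ->
  measurable_fun setT (fun x => \int[m2]_y F (x, y)).
Proof.
move=> bF F0; have [mF _] := bF; apply/measurable_EFinP.
have -> : EFin \o (fun x => \int[m2]_y F (x, y)) =
   fubini_F m2 (EFin \o F).
  by apply/funext => x; rewrite /= -Rint_EFin//; exact: bmf_pair.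
apply: measurable_fun_fubini_tonelli_F => //; exact/measurable_EFinP.
Qed.

(** Adding a constant makes a bounded function nonnegative; this is how Tonelli's theorem yields
    measurability of partial integrals and Fubini's theorem for signed functions. *)
Lemma bmf_shift F : bmf F -> exists2 M, 0 <= M & forall z, 0 <= F z + M.
Proof.
move=> [mF [M FM]]; exists `|M| => // z.
have := FM z; rewrite ler_norml => /andP[+ _]; have := ler_norm M; lra.
Qed.

Lemma bmf_Rint F : bmf F -> bmf (fun x => \int[m2]_y F (x, y)).
Proof.
move=> bF; have [mF [M FM]] := bF; split.
  have [N N0 FN] := bmf_shift bF.
  have -> : (fun x => \int[m2]_y F (x, y)) =
     (fun x => \int[m2]_y (F (x, y) + N) - N * fine (m2 setT)).
    apply/funext => x; rewrite RintD ?Rintegral_cst ?addrK//.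
      exact: bmf_pair.
    exact: bmf_cst.
  apply: measurable_funB => //; apply: (@measurable_Rint_ge0 (fun z => F z + N)) => //.
  by apply: bmfD => //; exact: bmf_cst.
exists (M * fine (m2 setT)) => x.
rewrite (le_trans (le_normr_Rintegral _ _))//; first exact/bmf_integrable/bmf_pair.
rewrite -Rintegral_cst//; apply: le_Rint => //; last exact: bmf_cst.
have [mf [N fN]] := bmf_pair x bF.
by split; [exact: measurableT_comp|exists N => y; rewrite normr_id].
Qed.

End fubini_bmf.

Lemma bmf_swap d1 d2 (T1 : measurableType d1) (T2 : measurableType d2) (R : realType)
  (F : T1 * T2 -> R) : bmf F -> bmf (fun z => F (z.2, z.1)).
Proof. by apply: bmf_comp; apply: measurable_fun_pair. Qed.

Section fubini_bmf2.
Context d1 d2 (T1 : measurableType d1) (T2 : measurableType d2) (R : realType).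
Variables (m1 : {finite_measure set T1 -> \bar R}) (m2 : {finite_measure set T2 -> \bar R}).
Implicit Types F : T1 * T2 -> R.

Lemma bmf_Rint2 F : bmf F -> bmf (fun y => \int[m1]_x F (x, y)).
Proof. by move=> /bmf_swap /(bmf_Rint m1). Qed.

Lemma Rint_fubini_ge0 F : bmf F -> (forall z, 0 <= F z) ->
  \int[m1]_x \int[m2]_y F (x, y) = \int[m2]_y \int[m1]_x F (x, y).
Proof.
move=> bF F0; have [mF _] := bF; apply: EFin_inj.
rewrite -Rint_EFin; last exact: bmf_Rint.
transitivity (\int[m1]_x \int[m2]_y (F (x, y))%:E)%E.
  by apply: eq_integral => x _; rewrite -Rint_EFin//; exact: bmf_pair.
transitivity (\int[m2]_y \int[m1]_x (F (x, y))%:E)%E.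
  by apply: (@fubini_tonelli _ _ _ _ _ m1 m2 (EFin \o F)) => //; exact/measurable_EFinP.
rewrite -[RHS]Rint_EFin; last exact: bmf_Rint2.
by apply: eq_integral => x _; rewrite -Rint_EFin//; exact: bmf_pair2.
Qed.

Lemma Rint_fubini F : bmf F ->
  \int[m1]_x \int[m2]_y F (x, y) = \int[m2]_y \int[m1]_x F (x, y).
Proof.
move=> bF; have [N N0 FN] := bmf_shift bF.
have bFN : bmf (fun z => F z + N) by apply: bmfD => //; exact: bmf_cst.
have := Rint_fubini_ge0 bFN FN => /=.
have -> : (fun x => \int[m2]_y (F (x, y) + N)) =
          (fun x => \int[m2]_y F (x, y) + N * fine (m2 setT)).
  apply/funext => x; rewrite RintD ?Rintegral_cst//; [exact: bmf_pair|exact: bmf_cst].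
have -> : (fun y => \int[m1]_x (F (x, y) + N)) =
          (fun y => \int[m1]_x F (x, y) + N * fine (m1 setT)).
  apply/funext => x; rewrite RintD ?Rintegral_cst//; [exact: bmf_pair2|exact: bmf_cst].
rewrite RintD; [|exact: bmf_Rint|exact: bmf_cst].
rewrite RintD; [|exact: bmf_Rint2|exact: bmf_cst].
by rewrite !Rintegral_cst// mulrAC => /addIr.
Qed.

End fubini_bmf2.

(** * Null sets of a product and of its sections *)

Section ae_prod.
Context d1 d2 (T1 : measurableType d1) (T2 : measurableType d2) (R : realType).
Variables (m1 : probability T1 R) (m2 : probability T2 R).

(** The type ascription makes the product measure a [probability], so that the lemmas on finite
    measures apply to it. *)
Definition prod_prob : probability (T1 * T2)%type R := (m1 \x m2)%E.

Lemma Rint_prod (F : T1 * T2 -> R) : bmf F ->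
  \int[prod_prob]_z F z = \int[m1]_x \int[m2]_y F (x, y).
Proof.
move=> bF; apply: EFin_inj; rewrite -Rint_EFin//.
have iF : (m1 \x m2)%E.-integrable setT (EFin \o F) by exact: (@bmf_integrable _ _ _ prod_prob).
rewrite -[LHS](integral12_prod_meas1 iF) -[RHS]Rint_EFin; last exact: bmf_Rint.
by apply: eq_integral => x _; rewrite -Rint_EFin//; exact: bmf_pair.
Qed.

Lemma ae_prod (P : T1 * T2 -> Prop) : {ae prod_prob, forall z, P z} ->
  {ae m1, forall x, {ae m2, forall y, P (x, y)}}.
Proof.
move=> [N [mN N0 PN]].
have /Rint_eq0P : \int[m1]_x \int[m2]_y (\1_N (x, y) : R) = 0.
  rewrite -Rint_prod; last exact: bmf_indic.
  by rewrite Rint_indic// -[RHS]/(fine 0%E); congr fine.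
have bN : bmf (\1_N : _ -> R) by exact: bmf_indic.
move=> /(_ (bmf_Rint _ bN)) H.
have := H (fun x => Rintegral_ge0 _ _); move=> {}H.
have {}H := H (fun x y _ => _).
apply: filterS (H _) => [x|]; last by [].
move/Rint_eq0P => /(_ (bmf_pair _ bN)) /(_ _) H2.
apply: filterS (H2 _) => [y|]; last by [].
move=> y0; apply: contrapT => nP; have : N (x, y) by apply: PN.
by move: y0; rewrite indicE => /eqP; rewrite pnatr_eq0 eqb0 => /negP; rewrite inE.
Qed.

(** Null sections make a set null only if the set is measurable, whence the condition on [P]. In
    [ae_prod] the indicator of a measurable null set containing the exceptional set is integrated
    instead. *)
Lemma prod_ae (P : T1 * T2 -> Prop) : measurable [set z | P z] ->
  {ae m1, forall x, {ae m2, forall y, P (x, y)}} -> {ae prod_prob, forall z, P z}.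
Proof.
move=> mP H; have mN := measurableC mP; set N := ~` _ in mN.
have bN : bmf (\1_N : _ -> R) by exact: bmf_indic.
exists N; split => //.
have : \int[m1]_x \int[m2]_y (\1_N (x, y) : R) = 0.
  apply/Rint_eq0P; first exact: bmf_Rint.
    by move=> x; apply: Rintegral_ge0 => y _.
  apply: filterS H => x H; apply/Rint_eq0P => //; first exact: bmf_pair.
  by apply: filterS H => y Py; rewrite indicE memNset.
rewrite -Rint_prod// Rint_indic// => N0.
by rewrite -[LHS]fineK ?fin_num_measure//; congr (_%:E).
Qed.

End ae_prod.

(** The vanishing of an integral at one endpoint of an edge controls almost all values of the other
    endpoint, so facts arise in one order of quantifiers and are often used in the other. Fubini's
    theorem for the indicator of the exceptional set exchanges them. *)
Lemma ae_swap d1 d2 (T1 : measurableType d1) (T2 : measurableType d2) (R : realType)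
  (m1 : probability T1 R) (m2 : probability T2 R) (P : T1 -> T2 -> Prop) :
  measurable [set z : T1 * T2 | P z.1 z.2] ->
  {ae m1, forall x, {ae m2, forall y, P x y}} ->
  {ae m2, forall y, {ae m1, forall x, P x y}}.
Proof.
move=> mP H; apply: (@ae_prod _ _ _ _ _ m2 m1 (fun z => P z.2 z.1)).
have mN := measurableC mP; set N := ~` _ in mN.
have bN : bmf (\1_N : _ -> R) by exact: bmf_indic.
have bN' := bmf_swap bN.
have mS : measurable [set z : T2 * T1 | P z.2 z.1].
  have ms : measurable_fun setT (fun z : T2 * T1 => (z.2, z.1)) by exact: measurable_fun_pair.
  by have := ms measurableT _ mP; rewrite setTI.
exists (~` [set z : T2 * T1 | P z.2 z.1]); split => //; first exact: measurableC.
have : \int[m2]_y \int[m1]_x (\1_N (x, y) : R) = 0.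
  rewrite -Rint_fubini//.
  apply/Rint_eq0P; first exact: bmf_Rint.
    by move=> x; apply: Rintegral_ge0 => y _.
  apply: filterS H => x H; apply/Rint_eq0P => //; first exact: bmf_pair.
  by apply: filterS H => y Py; rewrite indicE memNset.
rewrite -(Rint_prod m2 m1 bN').
have -> : (fun z : T2 * T1 => (\1_N (z.2, z.1) : R)) = \1_(~` [set z : T2 * T1 | P z.2 z.1]).
  by apply/funext => z; rewrite !indicE.
have mN' := measurableC mS.
rewrite Rint_indic// => N0.
by rewrite -[LHS]fineK ?fin_num_measure//; congr (_%:E).
Qed.

(** * Powers of a digraphon *)

Section measurable_sets.
Context d (T : measurableType d) (R : realType).
Implicit Types P Q : T -> Prop.

Lemma mset_imply P Q : measurable [set x | P x] -> measurable [set x | Q x] ->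
  measurable [set x | P x -> Q x].
Proof.
move=> mP mQ.
have -> : [set x | P x -> Q x] = ~` [set x | P x] `|` [set x | Q x].
  apply/seteqP; split=> x /=; last by move=> [|? _].
  by move=> PQ; have [/PQ|] := pselect (P x); [right|left].
by apply: measurableU => //; exact: measurableC.
Qed.

Lemma mset_not P : measurable [set x | P x] -> measurable [set x | ~ P x].
Proof. exact: measurableC. Qed.

Lemma mset_and P Q : measurable [set x | P x] -> measurable [set x | Q x] ->
  measurable [set x | P x /\ Q x].
Proof. exact: measurableI. Qed.

Lemma mset_or P Q : measurable [set x | P x] -> measurable [set x | Q x] ->
  measurable [set x | P x \/ Q x].
Proof. exact: measurableU. Qed.

Lemma mset_exists (P : nat -> T -> Prop) : (forall k, measurable [set x | P k x]) ->
  measurable [set x | exists k, P k x].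
Proof.
move=> mP; have -> : [set x | exists k, P k x] = \bigcup_k [set x | P k x].
  by apply/seteqP; split => x /= [k ?]; exists k.
exact: bigcup_measurable.
Qed.

Lemma mset_comp d' (T' : measurableType d') (h : T' -> T) P :
  measurable_fun setT h -> measurable [set x | P x] -> measurable [set x | P (h x)].
Proof. by move=> mh mP; have := mh measurableT _ mP; rewrite setTI. Qed.

Lemma mset_eq0 (f : T -> R) : measurable_fun setT f -> measurable [set x | f x = 0].
Proof. by move=> mf; have := mf measurableT [set 0] (measurable_set1 _); rewrite setTI. Qed.

Lemma mset_cst (P : Prop) : measurable [set x : T | P].
Proof.
have [p|np] := pselect P.
  by rewrite (_ : [set x | P] = setT)//; apply/seteqP; split.
by rewrite (_ : [set x | P] = set0)//; apply/seteqP; split.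
Qed.

End measurable_sets.

Section ae_lemmas.
Context d (T : measurableType d) (R : realType) (mu : probability T R).

Lemma prob_ae_ex (P : T -> Prop) : {ae mu, forall x, P x} -> exists x, P x.
Proof.
have pf : ProperFilter (almost_everywhere mu).
  by apply: ae_properfilter_algebraOfSetsType; rewrite [X in (_ < X)%E](probability_setT mu).
by move=> /(@filter_ex _ _ pf).
Qed.

Lemma not_ae_ex (P Q : T -> Prop) : ~ {ae mu, forall x, ~ P x} ->
  {ae mu, forall x, Q x} -> exists x, P x /\ Q x.
Proof.
move=> nP aQ; apply: contrapT => nE; apply: nP.
by apply: filterS aQ => x Qx Px; apply: nE; exists x.
Qed.

Lemma measure_eq0_ae (A : set T) : measurable A -> (mu A = 0)%E <-> {ae mu, forall x, ~ A x}.
Proof.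
move=> mA; split => [A0|]; first by exists A; split => // x /= /contrapT.
move=> [N [mN N0 AN]]; apply: (subset_measure0 _ _ _ N0) => // x Ax.
by apply: AN => /(_ Ax).
Qed.

End ae_lemmas.

Section powers.
Context d (T : measurableType d) (R : realType) (mu : probability T R).
Variable G : digraphon T R.

Lemma digraphon_ge0 z : 0 <= G z. Proof. by have /andP[] := digraphon_bounds G z. Qed.
Lemma digraphon_le1 z : G z <= 1. Proof. by have /andP[] := digraphon_bounds G z. Qed.

Lemma bmf_digraphon : bmf G.
Proof. by apply: bmf01; [exact: digraphon_measurable|exact: digraphon_bounds]. Qed.

(* [pw k] is the power of exponent [k.+1]. *)
Fixpoint pw (k : nat) (z : T * T) : R :=
  match k with
  | 0 => G z
  | m.+1 => \int[mu]_w (G (z.1, w) * pw m (w, z.2))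
  end.

Lemma bmf_glue (F H : T * T -> R) : bmf F -> bmf H ->
  bmf (fun q : (T * T) * T => F (q.1.1, q.2) * H (q.2, q.1.2)).
Proof.
move=> bF bH; apply: bmfM.
- apply: (@bmf_comp _ _ _ _ _ (fun q : (T * T) * T => (q.1.1, q.2))) => //.
  by apply: measurable_fun_pair => //; apply: measurableT_comp.
- apply: (@bmf_comp _ _ _ _ _ (fun q : (T * T) * T => (q.2, q.1.2))) => //.
  by apply: measurable_fun_pair => //; apply: measurableT_comp.
Qed.

Lemma bmf_convol (F H : T * T -> R) : bmf F -> bmf H ->
  bmf (fun z => \int[mu]_w (F (z.1, w) * H (w, z.2))).
Proof. by move=> bF bH; have := bmf_Rint mu (bmf_glue bF bH). Qed.

Lemma bmf_pw k : bmf (pw k).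
Proof.
elim: k => [|k IH]; first exact: bmf_digraphon.
by apply: bmf_convol => //; exact: bmf_digraphon.
Qed.

Lemma bmf_glue1 (F H : T * T -> R) x y : bmf F -> bmf H ->
  bmf (fun w => F (x, w) * H (w, y)).
Proof. by move=> bF bH; apply: bmfM; [exact: bmf_pair|exact: bmf_pair2]. Qed.

Lemma pw_ge0 k z : 0 <= pw k z.
Proof.
elim: k z => [|k IH] z /=; first exact: digraphon_ge0.
by apply: Rintegral_ge0 => w _; rewrite mulr_ge0 ?digraphon_ge0.
Qed.

Lemma Rint_le1 (f : T -> R) : bmf f -> (forall x, f x <= 1) -> \int[mu]_x f x <= 1.
Proof.
move=> bf f1; apply: (le_trans (le_Rint mu bf (bmf_cst T 1) f1)).
have := Rintegral_cst mu measurableT 1; rewrite /= => ->.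
by rewrite mul1r [X in fine X](probability_setT mu).
Qed.

Lemma pw_le1 k z : pw k z <= 1.
Proof.
elim: k z => [|k IH] z /=; first exact: digraphon_le1.
apply: Rint_le1; first by apply: bmf_glue1; [exact: bmf_digraphon|exact: bmf_pw].
by move=> w; rewrite mulr_ile1 ?digraphon_ge0 ?digraphon_le1 ?pw_ge0.
Qed.

(** With the shifted index, walks with [j.+1] and [k.+1] edges join to a walk with [(j + k).+2]
    edges, which has index [(j + k).+1]. *)
Lemma pwD j k x y : pw (j + k).+1 (x, y) = \int[mu]_w (pw j (x, w) * pw k (w, y)).
Proof.
elim: j x y => [|j IH] x y //.
transitivity (\int[mu]_w \int[mu]_v (G (x, w) * (pw j (w, v) * pw k (v, y)))).
  rewrite addSn; transitivity (\int[mu]_w (G (x, w) * pw (j + k).+1 (w, y))) => //.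
  by apply: eq_Rint => w; rewrite IH RintZ//; apply: bmf_glue1; exact: bmf_pw.
have bF : bmf (fun q : T * T => G (x, q.1) * (pw j (q.1, q.2) * pw k (q.2, y))).
  have bGx : bmf (fun w => G (x, w)) by apply: bmf_pair; exact: bmf_digraphon.
  apply: bmfM; first exact: (bmf_fst _ bGx).
  apply: bmfM; first by have := bmf_pw j; congr bmf; apply/funext => -[].
  have bky : bmf (fun w => pw k (w, y)) by apply: bmf_pair2; exact: bmf_pw.
  exact: (bmf_snd _ bky).
rewrite (Rint_fubini mu mu bF).
apply: eq_Rint => v /=; rewrite -RintZr; last first.
  by apply: bmf_glue1; [exact: bmf_digraphon|exact: bmf_pw].
by apply: eq_Rint => w; rewrite mulrA.
Qed.

Lemma pwD_eq0 j k x y : pw (j + k).+1 (x, y) = 0 <->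
  {ae mu, forall w, pw j (x, w) = 0 \/ pw k (w, y) = 0}.
Proof.
rewrite pwD; apply: (iff_trans (Rint_eq0P mu _ _)).
- by apply: bmf_glue1; exact: bmf_pw.
- by move=> w; rewrite mulr_ge0 ?pw_ge0.
split; apply: filterS => w.
  by move=> /eqP; rewrite mulf_eq0 => /orP[] /eqP ->; [left|right].
by move=> [] ->; rewrite ?mul0r ?mulr0.
Qed.

(** Walks are joined at a set of positive measure of midpoints. The form [~ {ae mu, forall w, ~ _}]
    expresses positive measure here and below. *)
Lemma pwD_gt0 j k x y : 0 < pw (j + k).+1 (x, y) <->
  ~ {ae mu, forall w, ~ (0 < pw j (x, w) /\ 0 < pw k (w, y))}.
Proof.
have gt0 m z : (0 < pw m z) = (pw m z != 0) by rewrite lt_def pw_ge0 andbT.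
rewrite gt0; split.
  move=> /eqP H N; apply/H/pwD_eq0; apply: filterS N => w.
  rewrite !gt0 => /not_andP[] /negP; rewrite negbK => /eqP ->; by [left|right].
move=> N; apply/eqP => /pwD_eq0 H; apply: N; apply: filterS H => w.
by rewrite !gt0 => -[] -> []; rewrite eqxx.
Qed.

Lemma mset_pw k : measurable [set z | 0 < pw k z].
Proof. by apply: measurable_pos_set; case: (bmf_pw k). Qed.

End powers.

Section transpose.
Context d (T : measurableType d) (R : realType) (mu : probability T R).
Variable G : digraphon T R.

Let Gt z := G (z.2, z.1).

Let mGt : measurable_fun setT Gt.
Proof. exact: bmf_measurable (bmf_swap (bmf_digraphon G)). Qed.

Definition transpose : digraphon T R :=
  Digraphon mGt (fun z => digraphon_bounds G (z.2, z.1)).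

Lemma pw_transpose k x y : pw mu transpose k (x, y) = pw mu G k (y, x).
Proof.
elim: k x y => [//|k IH] x y.
rewrite -[k in RHS]addn0 pwD /=; apply: eq_Rint => w.
by rewrite IH mulrC.
Qed.

End transpose.

(** * Irreducibility and reachability *)

Section irreducible.
Context d (T : measurableType d) (R : realType) (mu : probability T R).

(** Strong connectedness in terms of null sets: a set that almost no edge leaves is null or conull.
    The iterated form suits [ae_swap] and the reversal of edges. *)
Definition irreducible (G : digraphon T R) := forall A : set T, measurable A ->
  {ae mu, forall x, {ae mu, forall y, A x -> ~ A y -> G (x, y) = 0}} ->
  {ae mu, forall x, ~ A x} \/ {ae mu, forall x, A x}.

Lemma mset_edge (G : digraphon T R) (A : set T) : measurable A ->
  measurable [set z : T * T | A z.1 -> ~ A z.2 -> G z = 0].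
Proof.
move=> mA; apply: mset_imply; first exact: (mset_comp measurable_fst).
apply: mset_imply; first by apply: mset_not; exact: (mset_comp measurable_snd).
apply: mset_eq0; exact: digraphon_measurable.
Qed.

Lemma strongly_connected_irreducible (G : digraphon T R) :
  strongly_connected mu G -> irreducible G.
Proof.
move=> sc A mA nE; have mB := measurableC mA.
have [A0|A0] := eqVneq (mu A) 0%E; first by left; exact/measure_eq0_ae.
have [B0|B0] := eqVneq (mu (~` A)) 0%E.
  right; move/measure_eq0_ae: B0 => /(_ mB); apply: filterS => x; exact: contrapT.
have := sc A (~` A) mA mB (setUv A) (setICr A).
have aez : {ae prod_prob mu mu, forall z, A z.1 -> ~ A z.2 -> G z = 0}.
  by apply: prod_ae; [exact: mset_edge|exact: nE].
rewrite (@ae_eq_integral _ _ _ (prod_prob mu mu) _ (cst 0%E))//.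
- by rewrite integral0 ltxx !lt0e A0 B0 !measure_ge0 => /(_ isT isT).
- exact: measurableX.
- by apply/measurable_EFinP; apply: measurable_funTS; exact: digraphon_measurable.
- by apply: filterS aez => z H [/= Az nAz]; rewrite H.
Qed.

(** An edge of the transpose that leaves [A] is, reversed, an edge of [G] that leaves the complement
    of [A]. *)
Lemma irreducible_transpose (G : digraphon T R) :
  irreducible G -> irreducible (transpose G).
Proof.
move=> iG A mA nE; have mB := measurableC mA.
have [|H|H] := iG (~` A) mB; [|right|by left].
  apply: (@ae_swap _ _ _ _ _ mu mu (fun y x => (~` A) x -> ~ (~` A) y -> G (x, y) = 0)).
    have := mset_edge (transpose G) mA; congr measurable; apply/seteqP; split => -[x y] /= H nAy Ax.
      by apply: H => //; exact: contrapT.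
    by apply: H => //; exact.
  apply: filterS nE => x; apply: filterS => y H nAy /contrapT Ax.
  exact: H.
by apply: filterS H => x /contrapT.
Qed.

Section atomless.
Variable G : digraphon T R.
Hypotheses (Hmu : atomless mu) (iG : irreducible G).

(** Let [N] be the set of vertices of outdegree 0. If it had positive measure, atomlessness would
    give a subset [B] of strictly smaller positive measure. Almost no edge leaves [B], so [B] is
    conull, contradicting [mu B < mu N <= 1]. An atom can violate the claim: a single vertex without
    a loop is irreducible. *)
Lemma outdegree_gt0 : {ae mu, forall x, 0 < \int[mu]_y G (x, y)}.
Proof.
set g := fun x => \int[mu]_y G (x, y).
have bg : bmf g by apply: bmf_Rint; exact: bmf_digraphon.
have g0 x : 0 <= g x by apply: Rintegral_ge0 => y _; exact: digraphon_ge0.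
pose N := [set x | g x = 0].
have mN : measurable N by apply: mset_eq0; case: bg.
have [N0|N0] := eqVneq (mu N) 0%E.
  move/measure_eq0_ae : N0 => /(_ mN); apply: filterS => x gx.
  by rewrite lt_def g0 andbT; apply/eqP.
have [B [mB BN /andP[B0 BltN]]] := Hmu mN (ltac:(by rewrite lt0e N0/=)).
have [||H] := iG mB.
- apply: aeW => x.
  have [Bx|nBx] := pselect (B x); last by apply: aeW.
  have /Rint_eq0P : g x = 0 by exact: BN.
  move=> /(_ (bmf_pair _ (bmf_digraphon G)) (fun=> digraphon_ge0 _ _)).
  exact: filterS.
- by move/(measure_eq0_ae mu mB) => B00; rewrite [X in (_ < X)%E]B00 ltxx in B0.
- have /measure_eq0_ae : {ae mu, forall x, ~ (~` B) x} by apply: filterS H => x Bx; exact.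
  move=> /(_ (measurableC mB)) H0.
  have B1 : (mu B = 1)%E.
    by have := probability_setC mu (measurableC mB); rewrite setCK [X in (_ - X)%E]H0 sube0.
  move: BltN; rewrite [X in (X < _)%E]B1 => /lt_le_trans /(_ (probability_le1 mu mN)).
  by rewrite ltxx.
Qed.

End atomless.

Section reach.
Variable G : digraphon T R.
Hypothesis iG : irreducible G.
Variable v : nat -> T -> R.
Hypotheses (bv : forall k, bmf (v k)) (v_ge0 : forall k x, 0 <= v k x).
Hypothesis v0 : 0 < \int[mu]_x v 0%N x.
Hypothesis vS : forall k y, v k.+1 y = \int[mu]_x (v k x * G (x, y)).

Lemma reach_step y : {ae mu, forall x, forall k, 0 < v k x -> 0 < G (x, y) -> 0 < v k.+1 y}.
Proof.
apply: ae_foralln => k.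
have [v1|v1] := eqVneq (v k.+1 y) 0; last first.
  by apply: aeW => x _ _; rewrite lt_def v1 v_ge0.
have bh : bmf (fun x => v k x * G (x, y)) by apply: bmfM => //; exact: bmf_pair2 (bmf_digraphon G).
have h0 x : 0 <= v k x * G (x, y) by rewrite mulr_ge0 ?digraphon_ge0.
rewrite vS in v1; have := (Rint_eq0P mu bh h0).1 v1.
apply: filterS => x H vx Gx.
by have := mulr_gt0 vx Gx; rewrite H ltxx.
Qed.

(** By [reach_step], almost no edge leaves the set of points where some [v k] is positive, and [v0]
    excludes that this set is null. The sequence [v] is abstract in order to serve both the walks
    from one point and the walks from a set. *)
Lemma reach : {ae mu, forall y, exists k, 0 < v k y}.
Proof.
pose A := [set y | exists k, 0 < v k y].
have mA : measurable A.
  by apply: mset_exists => k; apply: measurable_pos_set; case: (bv k).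
have [|H|//] := iG mA.
  apply: (@ae_swap _ _ _ _ _ mu mu (fun y x => A x -> ~ A y -> G (x, y) = 0)).
    apply: (mset_comp (h := fun z : T * T => (z.2, z.1)) _ (mset_edge G mA)).
    exact: measurable_fun_pair.
  apply: aeW => y; apply: filterS (reach_step y) => x H [k vk] nAy.
  apply/eqP/negP => /negP G0; apply: nAy; exists k.+1; apply: H => //.
  by rewrite lt_def G0 digraphon_ge0.
move: v0; rewrite (_ : \int[mu]_x v 0%N x = 0) ?ltxx//.
apply/Rint_eq0P => //; apply: filterS H => x nA; apply/eqP/negP => /negP vx.
by apply: nA; exists 0%N; rewrite lt_def vx v_ge0.
Qed.

End reach.

End irreducible.

(** * Periodicity *)

(* [d] is the least positive difference of two elements. *)
Lemma semigroup_gcd (S : nat -> Prop) :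
  (forall n, S n -> (0 < n)%N) -> (forall m n, S m -> S n -> S (m + n)%N) ->
  (exists n, S n) ->
  exists d, [/\ (0 < d)%N, forall n, S n -> (d %| n)%N &
    exists M, forall m, (M <= m)%N -> S (m * d)%N].
Proof.
move=> Spos Sadd [s0 Ss0].
have Smul k n : S n -> S (k.+1 * n)%N.
  move=> Sn; elim: k => [|k IH]; first by rewrite mul1n.
  by rewrite mulSn; exact: Sadd.
pose Q d := `[< (0 < d)%N /\ exists s, S s /\ S (s + d)%N >].
have exQ : exists d, Q d.
  by exists s0; apply/asboolP; split; [exact: Spos|exists s0; split => //; exact: Sadd].
have [d /asboolP[d0 [s [Ss Ssd]]] dmin] := ex_minnP exQ.
have dvd t : S t -> (d %| t)%N.
  move=> St; apply: contraT; rewrite /dvdn -lt0n => r0.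
  have : Q (t %% d)%N.
    apply/asboolP; split=> //; case: (posnP (t %/ d)%N) => [q0|].
      have := divn_eq t d; rewrite q0 mul0n add0n => <-.
      by exists t; split => //; exact: Sadd.
    (* With [t = q * d + r], adding [r] to the element [q * (s + d) + s] gives the element
       [q.+1 * s + t]. A nonzero remainder [r] would thus be a difference smaller than [d]. *)
    move=> q0; exists ((t %/ d) * (s + d) + s)%N; split.
      by rewrite -(prednK q0); apply: Sadd => //; exact: Smul.
    have -> : ((t %/ d) * (s + d) + s + t %% d = (t %/ d).+1 * s + t)%N.
      by rewrite mulSn mulnDr; have := divn_eq t d; lia.
    by apply: Sadd => //; exact: Smul.
  move=> /dmin; rewrite leqNgt => /negP; case; exact: ltn_pmod.
(* With [s' = s / d] and [m = q * s' + j], the bound [s' ^ 2 <= m] gives [j < s' <= q], so that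
   [m * d = (q - j) * s + j * (s + d)] has a positive first coefficient. *)
exists d; split => //; exists ((s %/ d) * (s %/ d))%N => m mM.
have sd := divnK (dvd _ Ss); set s' := (s %/ d)%N in sd mM.
have s'0 : (0 < s')%N by rewrite lt0n; apply/eqP => s'0; have := Spos _ Ss; rewrite -sd s'0.
have qj := divn_eq m s'; set q := (m %/ s')%N in qj; set j := (m %% s')%N in qj.
have js' : (j < s')%N by exact: ltn_pmod.
have s'q : (s' <= q)%N by rewrite leq_divRL.
have -> : (m * d = (q - j) * s + j * (s + d))%N.
  rewrite qj -sd mulnDr addnA -mulnDl subnK ?(leq_trans (ltnW js'))//.
  by rewrite mulnDl mulnA.
have qj0 : (0 < q - j)%N by rewrite subn_gt0 (leq_trans js').
rewrite -(prednK qj0); case: (j) => [|j']; first by rewrite mul0n addn0; exact: Smul.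
by apply: Sadd; exact: Smul.
Qed.

(** * A set of positive measure joined to itself by walks of one length *)

Section fat_set.
Context d (T : measurableType d) (R : realType) (mu : probability T R).
Variable G : digraphon T R.
Hypotheses (Hmu : atomless mu) (iG : irreducible mu G).
Local Notation pw := (pw mu G).

(** For fixed endpoints, [pwD_gt0] says that the midpoints at which concatenation fails form a null
    set. Exchanging quantifiers gives generic points [w] at which walks concatenate for almost all
    endpoints and all lengths at once. *)
Lemma pw_transit : {ae mu, forall w, {ae mu, forall x, {ae mu, forall y,
  forall j k, 0 < pw j (x, w) -> 0 < pw k (w, y) -> 0 < pw (j + k).+1 (x, y)}}}.
Proof.
have mP : measurable [set q : (T * T) * T | forall j k,
    0 < pw j (q.1.1, q.2) -> 0 < pw k (q.2, q.1.2) -> 0 < pw (j + k).+1 q.1].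
  have -> : [set q : (T * T) * T | forall j k,
      0 < pw j (q.1.1, q.2) -> 0 < pw k (q.2, q.1.2) -> 0 < pw (j + k).+1 q.1] =
    ~` [set q | exists j, exists k, ~ (0 < pw j (q.1.1, q.2) -> 0 < pw k (q.2, q.1.2) -> 0 < pw (j + k).+1 q.1)].
    apply/seteqP; split=> q /=.
      by move=> H [j [k]]; apply; exact: H.
    by move=> H j k; apply: contrapT => H'; apply: H; exists j, k.
  apply: measurableC; apply: mset_exists => j; apply: mset_exists => k.
  apply: mset_not; apply: mset_imply; last apply: mset_imply.
  - apply: (mset_comp (h := fun q : (T * T) * T => (q.1.1, q.2))) (mset_pw mu G j).
    by apply: measurable_fun_pair => //; apply: measurableT_comp.
  - apply: (mset_comp (h := fun q : (T * T) * T => (q.2, q.1.2))) (mset_pw mu G k).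
    by apply: measurable_fun_pair => //; apply: measurableT_comp.
  - exact: (mset_comp measurable_fst (mset_pw mu G (j + k).+1)).
have := @ae_swap _ _ _ _ _ (prod_prob mu mu) mu
  (fun z w => forall j k, 0 < pw j (z.1, w) -> 0 < pw k (w, z.2) -> 0 < pw (j + k).+1 z) mP.
move=> H; have {H} : {ae mu, forall y, {ae prod_prob mu mu, forall z, forall j k,
    0 < pw j (z.1, y) -> 0 < pw k (y, z.2) -> 0 < pw (j + k).+1 z}}.
  apply: H; apply: aeW => -[x y]; apply: ae_foralln => j; apply: ae_foralln => k.
  have [p0|p0] := boolP (0 < pw (j + k).+1 (x, y)); first exact: aeW.
  have : {ae mu, forall w, ~ (0 < pw j (x, w) /\ 0 < pw k (w, y))}.
    by apply: contrapT => /pwD_gt0; exact/negP.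
  by apply: filterS => w H ? ?; case: H.
by apply: filterS => w /ae_prod; exact.
Qed.

Lemma reach_from : {ae mu, forall x, {ae mu, forall y, exists k, 0 < pw k (x, y)}}.
Proof.
apply: filterS (outdegree_gt0 Hmu iG) => x x0.
apply: (reach iG (v := fun k y => pw k (x, y))) => //.
- by move=> k; apply: bmf_pair; exact: bmf_pw.
- by move=> *; exact: pw_ge0.
- by move=> k y; rewrite -[k in LHS]addn0 pwD.
Qed.

End fat_set.

Section fat_set2.
Context d (T : measurableType d) (R : realType) (mu : probability T R).
Variable G : digraphon T R.
Hypotheses (Hmu : atomless mu) (iG : irreducible mu G).
Local Notation pw := (pw mu G).

Lemma reach_to : {ae mu, forall x, {ae mu, forall y, exists k, 0 < pw k (y, x)}}.
Proof.
apply: filterS (reach_from Hmu (irreducible_transpose iG)) => x.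
by apply: filterS => y [k]; rewrite pw_transpose; exists k.
Qed.

(* [A] collects the points that reach a generic point [x] in [b] steps and are
   reached from it in [a] steps. *)
Lemma fat_set : exists A n, [/\ measurable A, ~ {ae mu, forall x, ~ A x} &
  {ae mu, forall x, {ae mu, forall y, A x -> A y -> 0 < pw n (x, y)}}].
Proof.
have [x [[xt xf] xr]] := prob_ae_ex (filterI (filterI (pw_transit mu G) (reach_from Hmu iG)) reach_to).
(* Almost every [y] lies on a closed walk through [x]. As there are countably many pairs of lengths,
   one pair serves a set of positive measure. *)
have : ~ (forall a b, {ae mu, forall y, ~ (0 < pw a (x, y) /\ 0 < pw b (y, x))}).
  move=> H.
  have H' : {ae mu, forall y, forall a b, ~ (0 < pw a (x, y) /\ 0 < pw b (y, x))}.
    by apply: ae_foralln => a; apply: ae_foralln => b.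
  have [y [[/= [a ya] [b yb]] /(_ a b)]] := prob_ae_ex (filterI (filterI xf xr) H').
  by apply.
move=> /existsNP[a] /existsNP[b] H.
exists [set y | 0 < pw a (x, y) /\ 0 < pw b (y, x)], (b + a).+1; split => //.
  apply: mset_and.
    by apply: (mset_comp (h := fun y => (x, y)) _ (mset_pw mu G a)); exact: pair1_measurable.
  by apply: (mset_comp (h := fun y => (y, x)) _ (mset_pw mu G b)); exact: pair2_measurable.
apply: filterS xt => y; apply: filterS => z Hyz /= [_ yb] [za _].
exact: Hyz.
Qed.

End fat_set2.

Lemma mset_forall d (T : measurableType d) (P : nat -> T -> Prop) :
  (forall k, measurable [set x | P k x]) -> measurable [set x | forall k, P k x].
Proof.
move=> mP; have -> : [set x | forall k, P k x] = ~` [set x | exists k, ~ P k x].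
  apply/seteqP; split=> x /=; first by move=> H [k]; apply; exact: H.
  by move=> H k; apply: contrapT => nP; apply: H; exists k.
by apply: measurableC; apply: mset_exists => k; exact: mset_not.
Qed.

(** Taking the least index makes the level sets countable Boolean combinations of the sets [P k].
    Points without an index receive the default 0 of [xget], which is also measurable. *)
Lemma measurable_selection d (T : measurableType d) (P : nat -> T -> Prop) :
  (forall k, measurable [set x | P k x]) -> exists c : T -> nat,
  (forall x, (exists k, P k x) -> P (c x) x) /\
  forall m, measurable [set x | c x = m].
Proof.
move=> mP; pose least m x := P m x /\ forall i, (i < m)%N -> ~ P i x.
have least_uniq x m n : least m x -> least n x -> m = n.
  move=> [Pm Lm] [Pn Ln]; apply/eqP; rewrite eqn_leq (leqNgt m n) (leqNgt n m).
  by apply/andP; split; apply/negP => lt; [exact: (Lm _ lt Pn)|exact: (Ln _ lt Pm)].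
have least_ex x : (exists k, P k x) -> exists m, least m x.
  move=> [k Pk]; have ex : exists k, `[< P k x >] by exists k; apply/asboolP.
  have [m /asboolP Pm mmin] := ex_minnP ex; exists m; split => // i im Pi.
  by have := mmin i (asboolT Pi); rewrite leqNgt im.
exists (fun x => xget 0%N [set m | least m x]); split.
  by move=> x /least_ex ex; have /= [] := xgetPex 0%N ex.
move=> m.
have mleast n : measurable [set x | least n x].
  apply: mset_and => //; apply: mset_forall => i; apply: mset_imply; last exact: mset_not.
  exact: mset_cst.
have -> : [set x | xget 0%N [set m | least m x] = m] =
    [set x | least m x \/ ((forall n, ~ least n x) /\ m = 0%N)].
  apply/seteqP; split=> x /=.
    by case: xgetP => [n -> ln <-|H <-]; [left|right].
  move=> [lm|[H ->]]; last by rewrite xgetPN.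
  by case: xgetP => [n -> ln|/(_ m)//]; exact: least_uniq ln lm.
apply: mset_or => //; apply: mset_and; last exact: mset_cst.
by apply: mset_forall => n; exact: mset_not.
Qed.

Section concat.
Context d (T : measurableType d) (R : realType) (mu : probability T R).
Variable G : digraphon T R.
Local Notation pw := (pw mu G).

Lemma pw_concat3 j m l x y :
  ~ {ae mu, forall a, {ae mu, forall b,
      ~ [/\ 0 < pw j (x, a), 0 < pw m (a, b) & 0 < pw l (b, y)]}} ->
  0 < pw (j + (m + l).+1).+1 (x, y).
Proof.
move=> H; apply/pwD_gt0 => N; apply: H; apply: filterS N => a Na.
have [pa|pa] := pselect (0 < pw j (x, a)); last by apply: aeW => b [].
have : ~ (0 < pw (m + l).+1 (a, y)) by move=> pay; apply: Na.
rewrite pwD_gt0 => /contrapT; apply: filterS => b nb [_ ? ?]; exact: nb.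
Qed.

(** Both orders of quantifiers are used: the first starts the induction at a generic [x], the second
    appends a last edge [(z, y)] for fixed [y] and almost every [z]. It is applied to residues and
    to phases. *)
Lemma walk_ae (Q : nat -> T -> T -> Prop) :
  (forall k x z y, Q k x z -> Q 0%N z y -> Q k.+1 x y) ->
  {ae mu, forall x, {ae mu, forall y, 0 < G (x, y) -> Q 0%N x y}} ->
  {ae mu, forall y, {ae mu, forall x, 0 < G (x, y) -> Q 0%N x y}} ->
  {ae mu, forall x, {ae mu, forall y, forall k, 0 < pw k (x, y) -> Q k x y}}.
Proof.
move=> QS H1 H2; apply: filterS H1 => x H1; apply: ae_foralln.
elim=> [//|k IH]; apply: filterS H2 => y H2.
rewrite -[k in pw k.+1]addn0 => /pwD_gt0 N.
have [z [[pz Gz] [Qz Qy]]] := not_ae_ex N (filterI IH H2).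
by apply: (QS _ _ z); [exact: Qz|exact: Qy].
Qed.

End concat.

Section reach_set.
Context d (T : measurableType d) (R : realType) (mu : probability T R).
Variable G : digraphon T R.
Variables (A : set T) (mA : measurable A).
Local Notation pw := (pw mu G).

(** The density at [y] of walks with [k.+1] edges started in [A]. Its positivity means that walks
    reach [y] from a part of [A] of positive measure. *)
Definition massfrom k y : R := \int[mu]_x (\1_A x * pw k (x, y)).

Let bF k : bmf (fun z : T * T => (\1_A z.1 : R) * pw k z).
Proof. by apply: bmfM; [exact: bmf_fst (bmf_indic _ mA)|exact: bmf_pw]. Qed.

Lemma bmf_massfrom k : bmf (massfrom k).
Proof. by have := bmf_Rint2 mu (bF k); congr bmf. Qed.

Lemma massfrom_ge0 k y : 0 <= massfrom k y.
Proof. by apply: Rintegral_ge0 => x _; rewrite mulr_ge0 ?pw_ge0. Qed.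

Lemma massfromS k y : massfrom k.+1 y = \int[mu]_x (massfrom k x * G (x, y)).
Proof.
transitivity (\int[mu]_x \int[mu]_z (\1_A x * pw k (x, z) * G (z, y))).
  apply: eq_Rint => x; rewrite -[k in LHS]addn0 pwD /= -RintZ; last first.
    by apply: bmf_glue1; [exact: bmf_pw|exact: bmf_digraphon].
  by apply: eq_Rint => z; rewrite mulrA.
have bH : bmf (fun z : T * T => (\1_A z.1 * pw k z) * G (z.2, y)).
  apply: bmfM => //; apply: (bmf_snd T (f := fun z => G (z, y))).
  by apply: bmf_pair2; exact: bmf_digraphon.
have -> : (fun x => \int[mu]_z (\1_A x * pw k (x, z) * G (z, y))) =
    (fun x => \int[mu]_z (\1_A (x, z).1 * pw k (x, z) * G ((x, z).2, y))) by [].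
rewrite (Rint_fubini mu mu bH); apply: eq_Rint => z /=.
by rewrite RintZr//; exact: bmf_pair2 (bF k).
Qed.

Lemma massfrom_gt0 k y : 0 < massfrom k y <->
  ~ {ae mu, forall x, ~ (A x /\ 0 < pw k (x, y))}.
Proof.
apply: (iff_trans (Rint_gt0P mu _ _)).
- exact: bmf_pair2 (bF k).
- by move=> x; rewrite mulr_ge0 ?pw_ge0.
have e x : \1_A x * pw k (x, y) = 0 <-> ~ (A x /\ 0 < pw k (x, y)).
  rewrite indicE; have [xA|xA] := boolP (x \in A); rewrite ?mul1r ?mul0r.
    split=> [->|H]; first by rewrite ltxx => -[].
    apply/eqP/negP => /negP p0; apply: H; split; first exact: set_mem.
    by rewrite lt_def p0 pw_ge0.
  by split => // _ [/mem_set]; rewrite (negbTE xA).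
by split => H N; apply: H; apply: filterS N => x /e.
Qed.

Hypotheses (Hmu : atomless mu) (iG : irreducible mu G).
Hypothesis A_gt0 : ~ {ae mu, forall x, ~ A x}.

Lemma reach_massfrom : {ae mu, forall y, exists k, 0 < massfrom k y}.
Proof.
apply: (reach iG) => //.
- exact: bmf_massfrom.
- exact: massfrom_ge0.
- have -> : \int[mu]_y massfrom 0 y = \int[mu]_x (\1_A x * \int[mu]_y G (x, y)).
    rewrite -(Rint_fubini mu mu (bF 0)); apply: eq_Rint => x.
    by rewrite /= RintZ//; exact: bmf_pair (bmf_digraphon G).
  have [bO O0] : bmf (fun x => \int[mu]_y G (x, y)) /\ forall x, 0 <= \int[mu]_y G (x, y).
    split; first exact: bmf_Rint (bmf_digraphon G).
    by move=> x; apply: Rintegral_ge0 => y _; exact: digraphon_ge0.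
  apply/Rint_gt0P; first by apply: bmfM => //; exact: bmf_indic.
    by move=> x; rewrite mulr_ge0.
  move=> H; apply: A_gt0; apply: filterS2 H (outdegree_gt0 Hmu iG) => x /eqP.
  rewrite mulf_eq0 indicE => /orP[/eqP H _ Ax|/eqP -> ]; last by rewrite ltxx.
  by move: H; rewrite mem_set// => /eqP; rewrite oner_eq0.
- exact: massfromS.
Qed.

End reach_set.

(** * The period and the residues of walk lengths *)

Section period.
Context d (T : measurableType d) (R : realType) (mu : probability T R).
Variable G : digraphon T R.
Hypotheses (Hmu : atomless mu) (iG : irreducible mu G).
Local Notation pw := (pw mu G).

Section return_times.
Variables (A : set T) (n0 : nat).
Hypotheses (mA : measurable A) (A_gt0 : ~ {ae mu, forall x, ~ A x}).
Hypothesis An0 : {ae mu, forall x, {ae mu, forall y, A x -> A y -> 0 < pw n0 (x, y)}}.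

(** Here [m] counts edges, whence the index [m.-1] of [pw]; in this normalization [S] is closed
    under addition. *)
Let S m := (0 < m)%N /\
  {ae mu, forall x, {ae mu, forall y, A x -> A y -> 0 < pw m.-1 (x, y)}}.

Let S_swap m : S m ->
  {ae mu, forall y, {ae mu, forall x, A x -> A y -> 0 < pw m.-1 (x, y)}}.
Proof.
move=> [_]; apply: (@ae_swap _ _ _ _ _ mu mu (fun x y => A x -> A y -> 0 < pw m.-1 (x, y))).
apply: mset_imply; first exact: (mset_comp measurable_fst).
apply: mset_imply; first exact: (mset_comp measurable_snd).
have := mset_pw mu G m.-1; congr measurable; apply/seteqP; by split => -[].
Qed.

Let S_add m n : S m -> S n -> S (m + n)%N.
Proof.
move=> Sm /[dup] [[n0' _]] /S_swap Sn; have [m0 {}Sm] := Sm; split.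
  by rewrite addn_gt0 m0.
have -> : ((m + n).-1 = (m.-1 + n.-1).+1)%N by lia.
apply: filterS Sm => x Sm; apply: filterS Sn => y Sn Ax Ay.
apply/pwD_gt0 => N; apply: A_gt0; apply: filterS3 N Sm Sn => z N Sm Sn Az.
by apply: N; split; [exact: Sm|exact: Sn].
Qed.

Let S_n0 : S n0.+1. Proof. by split. Qed.

(** Walks between positive parts of [A] suffice: putting a walk with [n0.+1] edges inside [A] before
    and after them serves almost all pairs of endpoints in [A]. *)
Let S_sandwich m :
  ~ {ae mu, forall a, {ae mu, forall b, A a -> A b -> ~ 0 < pw m (a, b)}} ->
  S (n0 + (m + n0).+1).+2.
Proof.
move=> H; split=> //=; apply: filterS An0 => x Hx; apply: filterS (S_swap S_n0) => y Hy Ax Ay.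
apply: pw_concat3 => N; apply: H; apply: filterS2 Hx N => a Hx N.
apply: filterS2 Hy N => b Hy N Aa Ab pab; apply: N; split => //.
  exact: Hx.
exact: Hy.
Qed.

Let Gt := transpose G.
Let from := massfrom mu G A.
Let to := massfrom mu Gt A.

Let to_gt0 k x : 0 < to k x <-> ~ {ae mu, forall y, ~ (A y /\ 0 < pw k (x, y))}.
Proof.
apply: (iff_trans (massfrom_gt0 mu Gt mA k x)); split => H N; apply: H; apply: filterS N => y.
  by rewrite pw_transpose.
by rewrite pw_transpose.
Qed.

Let from_gt0 k x : 0 < from k x <-> ~ {ae mu, forall y, ~ (A y /\ 0 < pw k (y, x))}.
Proof. exact: massfrom_gt0. Qed.

Let reach_from_A : {ae mu, forall y, exists k, 0 < from k y}.
Proof. exact: reach_massfrom. Qed.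

Let reach_to_A : {ae mu, forall y, exists k, 0 < to k y}.
Proof. by apply: reach_massfrom => //; exact: irreducible_transpose. Qed.

(** A walk from [A] to [y] followed by one from [y] to [A] has [k + l + 2] edges; by [S_sandwich]
    this is a return time up to adding [n0.+1] twice. *)
Let closing : {ae mu, forall y, forall k l, 0 < from k y -> 0 < to l y ->
  S (n0 + ((k + l).+1 + n0).+1).+2}.
Proof.
apply: filterS (pw_transit mu G) => y Hy k l /from_gt0 fk /to_gt0 tl.
apply: S_sandwich => H; apply: fk; apply: filterS2 Hy H => a Hy H [Aa pka].
apply: tl; apply: filterS2 Hy H => b Hy H [Ab plb]; apply: H => //.
exact: Hy.
Qed.

Let through m x y j l : S m -> 0 < to j x -> 0 < from l y ->
  0 < pw (j + (m.-1 + l).+1).+1 (x, y).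
Proof.
move=> [m0 Sm] /to_gt0 tj /from_gt0 fl; apply: pw_concat3 => N.
apply: tj; apply: filterS2 Sm N => a Sm N [Aa pj].
apply: fl; apply: filterS2 Sm N => b Sm N [Ab pl].
by apply: N; split => //; exact: Sm.
Qed.

Let step y : {ae mu, forall x, forall k, 0 < from k x -> 0 < G (x, y) -> 0 < from k.+1 y}.
Proof.
apply: reach_step.
- by move=> k; exact: bmf_massfrom.
- by move=> k x; exact: massfrom_ge0.
- by move=> k z; exact: massfromS.
Qed.

Let mset_from k : measurable [set x | 0 < from k x].
Proof. by apply: measurable_pos_set; case: (bmf_massfrom mu G mA k). Qed.

Let step' : {ae mu, forall x, {ae mu, forall y,
  forall k, 0 < from k x -> 0 < G (x, y) -> 0 < from k.+1 y}}.
Proof.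
apply: (@ae_swap _ _ _ _ _ mu mu (fun y x => forall k, 0 < from k x -> 0 < G (x, y) -> 0 < from k.+1 y)).
  apply: mset_forall => k.
  apply: mset_imply; first exact: (mset_comp measurable_snd (mset_from k)).
  apply: mset_imply; last exact: (mset_comp measurable_fst (mset_from k.+1)).
  apply: (mset_comp (h := fun z : T * T => (z.2, z.1)) _ (mset_pw mu G 0)).
  exact: measurable_fun_pair.
by apply: aeW => y; exact: step.
Qed.

(** The value [c y] is the least index of a walk from [A] to [y], and its residue modulo [p] is the
    same for all such walks because return times are multiples of [p]. Conversely, a long walk from
    [x] to [y] is routed through [A], where every large multiple of [p] is available as a length. *)
Lemma period_from_fat_set : exists (p : nat) (c : T -> nat), [/\ (0 < p)%N,
  forall j, measurable [set x | (c x %% p)%N = j],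
  {ae mu, forall x, {ae mu, forall y, 0 < G (x, y) -> c y = (c x).+1 %[mod p]}},
  {ae mu, forall x, {ae mu, forall y, forall k,
    0 < pw k (x, y) -> c y = (c x + k.+1)%N %[mod p]}} &
  {ae mu, forall x, {ae mu, forall y, exists M, forall k, (M <= k)%N ->
    c y = (c x + k.+1)%N %[mod p] -> 0 < pw k (x, y)}}].
Proof.
have [p [p0 Sp [M SM]]] := semigroup_gcd (fun n => @proj1 _ _) S_add (ex_intro _ _ S_n0).
have [c [cP mc]] := measurable_selection mset_from.
have dvdp : {ae mu, forall y, forall k l, 0 < from k y -> 0 < to l y -> (p %| k + l + 2)%N}.
  apply: (filterS _ closing) => y H k l fk tl; have := Sp _ (H _ _ fk tl).
  rewrite (_ : _.+2 = n0.+1 * 2 + (k + l + 2))%N; last by lia.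
  by rewrite dvdn_addr// dvdn_mulr//; exact: Sp S_n0.
have good : {ae mu, forall y, [/\ 0 < from (c y) y, exists l, 0 < to l y &
    forall k, 0 < from k y -> k = c y %[mod p]]}.
  apply: filterS3 dvdp reach_from_A reach_to_A => y H /cP fc [l tl]; split => //.
    by exists l.
  (* Walks of indices [k] and [c y] from [A] to [y], completed by the same walk back to [A], both
     give multiples of [p]. *)
  move=> k fk; have [d1 d2] := (H _ _ fk tl, H _ _ fc tl).
  apply/eqP; rewrite -(eqn_modDr (l + 2)) !addnA.
  by rewrite (eqP (d1 : (_ %% _ == 0)%N)) (eqP (d2 : (_ %% _ == 0)%N)).
have edge1 : {ae mu, forall x, {ae mu, forall y, 0 < G (x, y) -> c y = (c x).+1 %[mod p]}}.
  apply: (filterS2 _ _ step' good) => x H [fx _ _]; apply: (filterS2 _ _ H good) => y {}H [_ _ cy] Gxy.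
  by rewrite -(cy _ (H _ fx Gxy)).
have edge2 : {ae mu, forall y, {ae mu, forall x, 0 < G (x, y) -> c y = (c x).+1 %[mod p]}}.
  apply: (filterS _ good) => y [_ _ cy]; apply: (filterS2 _ _ (step y) good) => x H [fx _ _] Gxy.
  by rewrite -(cy _ (H _ fx Gxy)).
have walk : {ae mu, forall x, {ae mu, forall y, forall k,
    0 < pw k (x, y) -> c y = (c x + k.+1)%N %[mod p]}}.
  apply: (walk_ae (Q := fun k x y => c y = (c x + k.+1)%N %[mod p])).
  - move=> k x z y xz zy; rewrite zy -modnDml xz modnDml; congr (_ %% _)%N; lia.
  - by apply: (filterS _ edge1) => x; apply: filterS => y; rewrite addn1.
  - by apply: (filterS _ edge2) => x; apply: filterS => y; rewrite addn1.
exists p, c; split => //.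
  move=> j; have -> : [set x | (c x %% p)%N = j] =
      [set x | exists m, c x = m /\ (m %% p)%N = j].
    by apply/seteqP; split => x /=; [exists (c x)|case=> m [->]].
  by apply: mset_exists => m; apply: mset_and => //; exact: mset_cst.
apply: (filterS2 _ _ walk good) => x {}walk [_ [j tj] _]; apply: (filterS2 _ _ walk good) => y {}walk [fy _ _].
(* There are [j.+1] edges from [x] to [A] and [(c y).+1] edges from [A] to [y]; from [M * p] on, all
   multiples of [p] are lengths of walks inside [A]. *)
exists (j + c y + M * p + 2)%N => k Mk ck.
have SMp : S (M.+1 * p)%N by exact: SM.
(* This one walk through [A] has known length and so determines [c y - c x] modulo [p]; the length
   left over for [A] is then a multiple of [p]. *)
have cyM := walk _ (through SMp tj fy).
have kge : (j + c y + 2 <= k.+1)%N by lia.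
have : (p %| k.+1 - (j + c y + 2))%N.
  rewrite -eqn_mod_dvd//; apply/eqP.
  have : (c x + k.+1 = c x + (j + ((M.+1 * p).-1 + c y).+1).+2 %[mod p])%N by rewrite -ck cyM.
  move=> /eqP; rewrite eqn_modDl => /eqP ->.
  have Mp0 : (0 < M.+1 * p)%N by rewrite muln_gt0.
  rewrite (_ : _.+2 = M.+1 * p + (j + c y + 2))%N; last by lia.
  by rewrite modnMDl.
move=> /dvdnP[m em].
have Sm : S (m * p)%N by apply: SM; rewrite -(leq_pmul2r p0); lia.
have := through Sm tj fy; congr (0 < pw _ _).
by have [mp0 _] := Sm; lia.
Qed.

End return_times.

Theorem period_exists : exists (p : nat) (c : T -> nat), [/\ (0 < p)%N,
  forall j, measurable [set x | (c x %% p)%N = j],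
  {ae mu, forall x, {ae mu, forall y, 0 < G (x, y) -> c y = (c x).+1 %[mod p]}},
  {ae mu, forall x, {ae mu, forall y, forall k,
    0 < pw k (x, y) -> c y = (c x + k.+1)%N %[mod p]}} &
  {ae mu, forall x, {ae mu, forall y, exists M, forall k, (M <= k)%N ->
    c y = (c x + k.+1)%N %[mod p] -> 0 < pw k (x, y)}}].
Proof.
have [A [n [mA A0 An]]] := fat_set Hmu iG.
exact: (period_from_fat_set mA A0 An).
Qed.

End period.

(** * Perron eigenfunctions *)

Section left_operator.
Context d (T : measurableType d) (R : realType) (mu : probability T R).
Implicit Types (K : T * T -> R) (f g : T -> R).

(** For [K = G] this is [digraphon_op] on real functions. The kernel is a parameter because powers
    of [G] and a symmetric minorant of such a power also act. *)
Definition lop K f (x : T) : R := \int[mu]_y (f y * K (y, x)).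

Lemma bmf_lop_integrand K f x : bmf K -> bmf f -> bmf (fun y => f y * K (y, x)).
Proof. by move=> bK bf; apply: bmfM => //; exact: bmf_pair2. Qed.

Lemma bmf_lop_kernel K f : bmf K -> bmf f -> bmf (fun z : T * T => f z.1 * K z).
Proof. by move=> bK bf; apply: bmfM => //; exact: bmf_fst. Qed.

Lemma bmf_lop K f : bmf K -> bmf f -> bmf (lop K f).
Proof. by move=> bK bf; have := bmf_Rint2 mu (bmf_lop_kernel bK bf); congr bmf. Qed.

Lemma lop_ge0 K f x : (forall z, 0 <= K z) -> (forall x, 0 <= f x) -> 0 <= lop K f x.
Proof. by move=> K0 f0; apply: Rintegral_ge0 => y _; rewrite mulr_ge0. Qed.

Lemma lopZ K c f x : bmf K -> bmf f -> lop K (fun y => c * f y) x = c * lop K f x.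
Proof.
move=> bK bf; rewrite -RintZ; last exact: bmf_lop_integrand.
by apply: eq_Rint => y; rewrite mulrA.
Qed.

Lemma lop_sum K n (f : nat -> T -> R) x : bmf K -> (forall i, bmf (f i)) ->
  lop K (fun y => \sum_(i < n) f i y) x = \sum_(i < n) lop K (f i) x.
Proof.
move=> bK bf; transitivity (\int[mu]_y \sum_(i < n) (f i y * K (y, x))).
  by apply: eq_Rint => y; rewrite mulr_suml.
by apply: (@Rint_sum _ _ _ mu n (fun i y => f i y * K (y, x))) => i; exact: bmf_lop_integrand.
Qed.

Lemma le_lop K K' f g x : bmf K -> bmf K' -> bmf f -> bmf g ->
  (forall z, 0 <= K z <= K' z) -> (forall y, 0 <= f y <= g y) -> lop K f x <= lop K' g x.
Proof.
move=> bK bK' bf bg KK' fg; apply: le_Rint; [exact: bmf_lop_integrand..|].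
by move=> y; have /andP[? ?] := KK' (y, x); have /andP[? ?] := fg y; rewrite ler_pM.
Qed.

Lemma lop_adjoint K f g : bmf K -> bmf f -> bmf g ->
  \int[mu]_x (lop K f x * g x) = \int[mu]_y (f y * \int[mu]_x (K (y, x) * g x)).
Proof.
move=> bK bf bg.
have bF : bmf (fun z : T * T => f z.1 * K z * g z.2).
  by apply: bmfM; [exact: bmf_lop_kernel|exact: bmf_snd].
transitivity (\int[mu]_x \int[mu]_y (f y * K (y, x) * g x)).
  by apply: eq_Rint => x; rewrite RintZr//; exact: bmf_lop_integrand.
rewrite -(Rint_fubini mu mu bF); apply: eq_Rint => y /=.
rewrite -RintZ; last by apply: bmfM => //; exact: bmf_pair.
by apply: eq_Rint => x; rewrite mulrA.
Qed.

Definition iterates K n : T -> R := iter n (lop K) (fun=> 1).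

Lemma bmf_iterates K n : bmf K -> bmf (iterates K n).
Proof. by move=> bK; elim: n => [|n IH]; [exact: bmf_cst|exact: bmf_lop]. Qed.

Lemma iterates_ge0 K n x : (forall z, 0 <= K z) -> 0 <= iterates K n x.
Proof. by move=> K0; elim: n x => [|n IH] x //=; exact: lop_ge0. Qed.

(* The iterates [u] of a symmetric kernel satisfy [<u (2 n), 1> = <u n, u n>], which is at
   least [<u n, 1>^2]. *)
Lemma symmetric_iterates K n : bmf K -> (forall z, 0 <= K z) ->
  (forall x y, K (x, y) = K (y, x)) ->
  (\int[mu]_x iterates K 1 x) ^+ (2 ^ n) <= \int[mu]_x iterates K (2 ^ n) x.
Proof.
move=> bK K0 Ksym.
have adj i j : \int[mu]_x (iterates K i x * iterates K j x) = \int[mu]_x iterates K (i + j) x.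
  elim: i j => [|i IH] j; first by apply: eq_Rint => x; rewrite mul1r.
  rewrite addSnnS -IH [LHS]lop_adjoint//; [|exact: bmf_iterates..].
  by apply: eq_Rint => y; congr (_ * _); apply: eq_Rint => x; rewrite Ksym mulrC.
elim: n => [|n IH]; first by rewrite expr1.
have [bn n0] := (bmf_iterates (2 ^ n) bK, fun x => iterates_ge0 (2 ^ n) x K0).
rewrite expnS mulnC exprM expr2 muln2 -addnn -adj.
set u := iterates K (2 ^ n) in IH bn n0 *; set m := \int[mu]_x u x in IH *.
apply: (@le_trans _ _ (m * m)).
  by apply: ler_pM => //; rewrite exprn_ge0//; apply: Rintegral_ge0 => x _; exact: iterates_ge0.
(* Cauchy-Schwarz against the constant 1, as nonnegativity of a variance. *)
have : 0 <= \int[mu]_x ((u x - m) * (u x - m)).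
  by apply: Rintegral_ge0 => x _; rewrite -expr2 sqr_ge0.
have -> : \int[mu]_x ((u x - m) * (u x - m)) = \int[mu]_x (u x * u x - (2 * m * u x - m * m)).
  by apply: eq_Rint => x; lra.
rewrite RintB; [|exact: bmfM|by apply: bmfB; [exact: bmfZ|exact: bmf_cst]].
rewrite RintB; [|exact: bmfZ|exact: bmf_cst]; rewrite RintZ//.
by rewrite Rintegral_cst// [X in fine X](probability_setT mu) /= -/m; lra.
Qed.

End left_operator.

Section iterates_mass.
Context d (T : measurableType d) (R : realType) (mu : probability T R).
Variable G : digraphon T R.
Local Notation pw := (pw mu G).
Local Notation op := (lop mu G).
Local Notation t := (iterates mu G).
Let bG := bmf_digraphon G.

Definition mass n : R := \int[mu]_x t n x.

Let bt n : bmf (t n). Proof. exact: bmf_iterates. Qed.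
Let t_ge0 n x : 0 <= t n x. Proof. by apply: iterates_ge0; exact: digraphon_ge0. Qed.

Lemma iter_op_pw k f x : bmf f -> iter k.+1 op f x = lop mu (pw k) f x.
Proof.
move=> bf; elim: k x => [//|k IH] x.
transitivity (\int[mu]_z (lop mu (pw k) f z * G (z, x))).
  by apply: eq_Rint => z; rewrite -IH.
rewrite lop_adjoint//; [|exact: bmf_pw|exact: bmf_pair2].
by apply: eq_Rint => y; congr (_ * _); rewrite -[k in RHS]addn0 pwD.
Qed.

Lemma op_le_integral f x : bmf f -> (forall y, 0 <= f y) -> op f x <= \int[mu]_y f y.
Proof.
move=> bf f0; apply: le_Rint => //; first exact: bmf_lop_integrand.
by move=> y; rewrite ler_piMr ?digraphon_le1.
Qed.

Lemma mass_ge0 n : 0 <= mass n. Proof. by apply: Rintegral_ge0. Qed.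

Lemma mass0 : mass 0 = 1.
Proof.
by rewrite /mass /t/= Rintegral_cst// [X in fine X](probability_setT mu) mul1r.
Qed.

(** A kernel at most 1 bounds the image of a nonnegative function by its integral, so
    [t n.+1 <= mass n]; monotonicity of the operator propagates this. The application spent on it
    accounts for the successor in [mass_submul]. *)
Lemma iterates_le n m x : t (n + m).+1 x <= mass n * t m x.
Proof.
elim: m x => [|m IH] x.
  by rewrite addn0 mulr1; exact: op_le_integral.
rewrite addnS -[leLHS]/(op (t (n + m).+1) x) -[t m.+1 x]/(op (t m) x) -lopZ//.
apply: le_lop; [exact: bG|exact: bG|exact: bt|exact: bmfZ|..].
  by move=> z; rewrite digraphon_ge0/=.
by move=> y; rewrite t_ge0 IH.
Qed.

Lemma mass_submul n m : mass (n + m).+1 <= mass n * mass m.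
Proof.
rewrite -RintZ//; apply: le_Rint => //; first exact: bmfZ.
by move=> x; exact: iterates_le.
Qed.

Lemma mass_noninc n m : (n <= m)%N -> mass m <= mass n.
Proof.
move=> /subnK <-; elim: (m - n)%N => [//|k IH].
by rewrite addSn (le_trans (mass_submul 0 (k + n)))// mass0 mul1r.
Qed.

Hypotheses (Hmu : atomless mu) (iG : irreducible mu G).

Lemma mass_geometric : exists2 c : R, 0 < c <= 1 & forall n, c ^+ n.+1 <= mass n.
Proof.
have [A [n [mA A0 An]]] := fat_set Hmu iG.
pose K z := Num.min (pw n z) (pw n (z.2, z.1)).
have bK : bmf K by apply: bmf_min; [exact: bmf_pw|exact: bmf_swap (bmf_pw mu G n)].
have K0 z : 0 <= K z by rewrite le_min !pw_ge0.
have Ksym x y : K (x, y) = K (y, x) by rewrite /K/= minC.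
have Kpw z : K z <= pw n z by rewrite ge_min lexx.
set q := \int[mu]_x iterates mu K 1 x.
have q0 : 0 < q.
  have bK1 : bmf (iterates mu K 1) by exact: bmf_iterates.
  apply/Rint_gt0P => // [x|H]; first exact: iterates_ge0.
  have H2 : {ae mu, forall y, {ae mu, forall x, A x -> A y -> 0 < pw n (x, y)}}.
    move: An; apply: (@ae_swap _ _ _ _ _ mu mu (fun x y => A x -> A y -> 0 < pw n (x, y))).
    apply: mset_imply; first exact: (mset_comp measurable_fst).
    apply: mset_imply; first exact: (mset_comp measurable_snd).
    have := mset_pw mu G n; congr measurable; apply/seteqP; by split => -[].
  apply: (A0); apply: filterS3 H An H2 => x; rewrite /iterates/=.
  move=> /(Rint_eq0P mu _ _) H An1 An2 Ax.
  have {}H : {ae mu, forall y, 1 * K (y, x) = 0}.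
    apply: H; first exact: bmf_lop_integrand (bmf_cst _ 1).
    by move=> y; rewrite mul1r.
  apply: A0; apply: filterS3 H An1 An2 => y + An1 An2 Ay.
  by rewrite mul1r => /eqP; rewrite gt_eqF// lt_min An1 ?An2.
have q1 : q <= 1.
  apply: Rint_le1; first exact: bmf_iterates.
  move=> x; apply: Rint_le1; first exact: bmf_lop_integrand (bmf_cst _ 1).
  by move=> y; rewrite mul1r (le_trans (Kpw _))// pw_le1.
have itK j x : iterates mu K j x <= t (j * n.+1) x.
  elim: j x => [|j IH] x; first by rewrite mul0n.
  rewrite mulSn /t/iterates iterD iter_op_pw -/(iterates mu G _)//.
  apply: le_lop => //; [exact: bmf_pw|exact: bmf_iterates|..].
    by move=> z; rewrite K0 Kpw.
  by move=> y; rewrite IH iterates_ge0.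
(* The lower bound [q ^+ (2 ^ s)] is available only at powers of two. The least [2 ^ s] above [m] is
   at most [2 * m.+1], which costs a square, and [mass] is nonincreasing. *)
exists (q ^+ 2); first by rewrite exprn_gt0// exprn_ile1// ltW.
move=> m; set s := up_log 2 m.+1.
have ms : (m < 2 ^ s)%N by exact: up_logP.
have s2 : (2 ^ s <= 2 * m.+1)%N.
  case es : s => [|s']; first by rewrite expn0 mulnS.
  rewrite expnS leq_mul2l/= leqNgt; apply/negP => lt.
  by have := up_log_min (isT : (1 < 2)%N) (ltnW lt); rewrite -/s es ltnn.
apply: (@le_trans _ _ (mass (2 ^ s * n.+1))); last first.
  by apply: mass_noninc; rewrite (leq_trans (ltnW ms))// leq_pmulr.
apply: (@le_trans _ _ (\int[mu]_x iterates mu K (2 ^ s) x)); last first.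
  by apply: le_Rint => //; exact: bmf_iterates.
apply: (le_trans _ (symmetric_iterates mu s bK K0 Ksym)).
by rewrite -exprM ler_wiXn2l ?(ltW q0).
Qed.

End iterates_mass.

Lemma pred_split (N M : nat) : (N.+2 <= M)%N ->
  [/\ M.-1 = (N + (M.-1 - N.+1)).+1, M = ((M.-1 - N.+1) + N.+2)%N & (N <= M.-1)%N].
Proof. by move=> ?; split; lia. Qed.

(** * The critical scale of a submultiplicative sequence *)

Section critical_scale.
Variable R : realType.

Lemma bernoulli_ineq (y : R) n : 0 <= y -> 1 + n%:R * y <= (1 + y) ^+ n.
Proof.
move=> y0; elim: n => [|n IH]; first by rewrite mul0r addr0.
rewrite exprSr (le_trans _ (ler_wpM2r _ IH)) ?addr_ge0//.
by rewrite mulrS; have := mulr_ge0 (ler0n R n) (sqr_ge0 y); nra.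
Qed.

Lemma expr_unbounded (x b : R) : 1 < x -> exists n, b < x ^+ n.
Proof.
move=> x1; have y0 : 0 < x - 1 by lra.
set z := b / (x - 1); pose N := Num.bound `|z|.
have zb : z < N%:R := le_lt_trans (ler_norm z) (archi_boundP (normr_ge0 z)).
exists N.
have -> : x = 1 + (x - 1) by lra.
apply: lt_le_trans (bernoulli_ineq _ (ltW y0)).
by move: zb; rewrite /z ltr_pdivrMr//; lra.
Qed.

Lemma expr_slack (v : R) n : 0 <= v < 1 -> exists2 e, 0 < e & (1 + e) ^+ n * v < 1.
Proof.
move=> /andP[v0 v1]; elim: n => [|n [e e0 IH]]; first by exists 1; rewrite ?ltr01 ?mul1r.
set u := (1 + e) ^+ n * v in IH.
have u0 : 0 <= u by rewrite mulr_ge0 ?exprn_ge0//; lra.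
pose e' := Num.min e ((1 - u) / 2).
have e'0 : 0 < e' by rewrite lt_min e0/=; lra.
have e'e : e' <= e by rewrite ge_min lexx.
have e'u : e' <= (1 - u) / 2 by rewrite ge_min lexx orbT.
exists e' => //; rewrite exprS -mulrA.
have : (1 + e') ^+ n * v <= u.
  by apply: ler_wpM2r => //; apply: lerXn2r; rewrite ?nnegrE; lra.
have : 0 <= (1 + e') ^+ n * v by rewrite mulr_ge0 ?exprn_ge0//; lra.
set z := _ * v; move=> z0 zu; nra.
Qed.

Variables (a : nat -> R) (c : R).
Hypotheses (c01 : 0 < c <= 1) (ac : forall n, c ^+ n.+1 <= a n) (a0 : a 0%N = 1).
Hypothesis a_submul : forall n m, a (n + m).+1 <= a n * a m.

Let c0 : 0 < c. Proof. by case/andP: c01. Qed.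
Let a_gt0 n : 0 < a n. Proof. by rewrite (lt_le_trans _ (ac n))// exprn_gt0. Qed.

(* [w] is the inverse of the growth rate of [a]. *)
Lemma critical_scale : exists w : R, [/\ 1 <= w, forall n, 1 <= w ^+ n.+1 * a n &
  forall (e : R) N0, 0 < e -> exists2 N, (N0 <= N)%N &
    w ^+ N * a N <= e * \sum_(n < N) w ^+ n * a n].
Proof.
(* The subcritical scales: one [n] with [t ^+ n.+1 * a n < 1] forces decay along the multiples of
   [n.+1]. They are bounded by [c^-1] because of [ac]. *)
pose W := [set t : R | 0 <= t /\ exists n, t ^+ n.+1 * a n < 1].
have W0 : W 0 by split => //; exists 0%N; rewrite expr1 mul0r ltr01.
have Wub t : W t -> t <= c^-1.
  move=> [t0 [n tn]]; rewrite leNgt; apply/negP => ct.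
  have : 1 <= t ^+ n.+1 * c ^+ n.+1.
    by rewrite -exprMn exprn_ege1// -(mulVf (lt0r_neq0 c0)) ler_pM2r// ltW.
  move/le_trans => /(_ _ (ler_wpM2l (exprn_ge0 _ t0) (ac n))) /le_lt_trans /(_ tn).
  by rewrite ltxx.
have supW : has_sup W by split; [exists 0|exists c^-1].
pose w := sup W.
have w_ge t : W t -> t <= w by move=> Wt; exact: ub_le_sup supW.2 _ Wt.
have w0 : 0 <= w by exact: w_ge.
(* The condition defining [W] is open in [t], so it fails at the supremum. *)
have wW n : 1 <= w ^+ n.+1 * a n.
  rewrite leNgt; apply/negP => wn.
  have wa0 : 0 <= w ^+ n.+1 * a n by rewrite mulr_ge0 ?exprn_ge0// ltW.
  have [|e e0 we] := @expr_slack (w ^+ n.+1 * a n) n.+1; first by rewrite wa0.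
  have Wwe : W (w * (1 + e)).
    by split; [rewrite mulr_ge0//; lra|exists n; rewrite exprMn [X in X * _]mulrC -mulrA].
  have wpos : 0 < w.
    have /w_ge : W (1 / 2) by split; [lra|exists 0%N; rewrite expr1 a0; lra].
    lra.
  have := w_ge _ Wwe; nra.
have w1 : 1 <= w by have := wW 0%N; rewrite expr1 a0 mulr1.
(* If from [N0] on each term exceeds [e] times the sum of its predecessors, the partial sums grow at
   least like [(1 + e) ^+ k]. *)
exists w; split => // e N0 e0; apply: contrapT => noN.
pose s N := \sum_(n < N) w ^+ n * a n.
have sS N : s N.+1 = s N + w ^+ N * a N by rewrite /s big_ord_recr.
have big N : (N0 <= N)%N -> e * s N < w ^+ N * a N.
  by move=> N0N; rewrite ltNge; apply/negP => H; apply: noN; exists N.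
have s_ge1 N : 1 <= s N.+1.
  elim: N => [|N IH]; first by rewrite sS /s big_ord0 add0r expr0 a0 mul1r.
  by rewrite sS (le_trans IH)// lerDl mulr_ge0 ?exprn_ge0// ltW.
have growth k : (1 + e) ^+ k <= s (N0 + k).+1.
  elim: k => [|k IH]; first by rewrite addn0.
  rewrite addnS sS exprS.
  have := big (N0 + k).+1 (leq_trans (leq_addr k N0) (leqnSn _)).
  have : (1 + e) * (1 + e) ^+ k <= (1 + e) * s (N0 + k).+1 by apply: ler_wpM2l => //; lra.
  lra.
(* A subcritical [t] close to [w] shows that [w ^+ M * a M.-1] is at most [h ^+ M] with
   [h = 1 + e / 2] when [n.+1] divides [M]. This growth is too slow for the previous bound. *)
have [t [t0 [n tn]] wt] : exists2 t, W t & w / (1 + e / 2) < t.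
  apply: (sup_gt supW.1); rewrite -/w ltr_pdivrMr; last by lra.
  nra.
pose h := 1 + e / 2.
have h1 : 1 < h by rewrite /h; lra.
have wh : w ^+ n.+1 * a n <= h ^+ n.+1.
  have wth : w <= t * h by rewrite -ler_pdivrMr ?ltW//; lra.
  have : w ^+ n.+1 <= t ^+ n.+1 * h ^+ n.+1.
    by rewrite -exprMn; apply: lerXn2r => //; rewrite nnegrE// mulr_ge0//; lra.
  move/(ler_wpM2r (ltW (a_gt0 n)))/le_trans; apply.
  rewrite mulrAC ler_piMl// ?ltW// exprn_gt0//; lra.
have subm k : w ^+ (k.+1 * n.+1) * a (k.+1 * n.+1).-1 <= h ^+ (k.+1 * n.+1).
  elim: k => [|k IH]; first by rewrite mul1n.
  have -> : (k.+2 * n.+1 = n.+1 + k.+1 * n.+1)%N by rewrite mulSn.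
  have -> : ((n.+1 + k.+1 * n.+1).-1 = (n + (k.+1 * n.+1).-1).+1)%N.
    by rewrite mulSn !addSn /= addnS.
  rewrite !exprD; apply: (@le_trans _ _ ((w ^+ n.+1 * a n) * (w ^+ (k.+1 * n.+1) * a (k.+1 * n.+1).-1))).
    rewrite mulrACA; apply: ler_wpM2l; first by rewrite mulr_ge0 ?exprn_ge0.
    exact: a_submul.
  by apply: ler_pM => //; rewrite mulr_ge0 ?exprn_ge0// ltW.
have x1 : 1 < (1 + e) / h by rewrite ltr_pdivlMr ?mul1r /h; lra.
have [k xk] := expr_unbounded ((1 + e) ^+ N0.+2 / e) x1.
(* Being above [k], [M] makes the ratio of the two growth rates beat the constant; being at least
   [N0.+2], it puts [M.-1] in the range of [growth]. *)
pose q := (k + N0).+2; pose M := (q * n.+1)%N.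
have Mq : (q <= M)%N by rewrite leq_pmulr.
have kM : (k <= M)%N by rewrite (leq_trans _ Mq)// /q -addn2 -addnA leq_addr.
have [M1 M2 M3] : [/\ M.-1 = (N0 + (M.-1 - N0.+1)).+1,
    M = ((M.-1 - N0.+1) + N0.+2)%N & (N0 <= M.-1)%N].
  by apply: pred_split; rewrite (leq_trans _ Mq)// /q !ltnS leq_addl.
have h0 : 0 < h by lra.
have A1 : w ^+ M * a M.-1 <= h ^+ M by exact: subm.
have A2 : e * s M.-1 < w ^+ M.-1 * a M.-1 by exact: big.
have A3 := growth (M.-1 - N0.+1)%N; rewrite -M1 in A3.
have A4 : w ^+ M.-1 * a M.-1 <= w ^+ M * a M.-1.
  by apply: ler_wpM2r; [exact: ltW|apply: ler_weXn2l => //; exact: leq_pred].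
have A5 : e * (1 + e) ^+ (M.-1 - N0.+1) < h ^+ M.
  by apply: (le_lt_trans (ler_wpM2l (ltW e0) A3)); apply: (lt_le_trans A2); apply: (le_trans A4).
have A6 : (1 + e) ^+ M = (1 + e) ^+ (M.-1 - N0.+1) * (1 + e) ^+ N0.+2.
  by rewrite -exprD -M2.
have A7 : (1 + e) ^+ N0.+2 / e < ((1 + e) / h) ^+ M.
  by apply: (lt_le_trans xk); apply: ler_weXn2l => //; exact: ltW.
have E0 : 0 < (1 + e) ^+ N0.+2 by rewrite exprn_gt0//; lra.
have H0 : 0 < h ^+ M by rewrite exprn_gt0.
rewrite expr_div_n A6 ltr_pdivlMr// in A7.
have z0 : 0 < (1 + e) ^+ N0.+2 / e by rewrite divr_gt0.
have zE : (1 + e) ^+ N0.+2 = (1 + e) ^+ N0.+2 / e * e by rewrite divfK// gt_eqF.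
rewrite {2}zE mulrCA ltr_pM2l// in A7.
by have := lt_trans A5 A7; rewrite mulrC ltxx.
Qed.

End critical_scale.

(** * Generalized limits and weak limits of densities *)

Section ultralimit.
Variable R : realType.
Implicit Types u v : nat -> R.

Definition bounded_seq u := exists M, forall k, `|u k| <= M.

Lemma ultrafilter_cvg (U : set_system nat) u : UltraFilter U -> bounded_seq u ->
  exists l : R, u @ U --> l.
Proof.
move=> ultraU [M uM]; have propU : ProperFilter U by exact: ultra_proper.
have FM : (u @ U) `[- M, M]%classic.
  have : U (u @^-1` `[- M, M]%classic).
    apply: filterS (@filterT _ U _) => k _ /=.
    by rewrite in_itv/= -ler_norml; exact: uM.
  by [].
have [l [_ Ul]] := segment_compact (fmap_proper_filter u propU) FM.
exists l => B /= Bl.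
have [//|nB] := in_ultra_setVsetC (u @^-1` B) ultraU.
have [x []] := Ul (~` B) B nB Bl.
by [].
Qed.

(** Every bounded sequence converges along an ultrafilter finer than [\oo], by compactness of
    intervals; thus one choice serves all test functions and no subsequence is extracted. *)
Lemma ultralimit : exists L : (nat -> R) -> R, [/\
  forall u v, bounded_seq u -> bounded_seq v -> L (fun k => u k + v k) = L u + L v,
  forall c u, bounded_seq u -> L (fun k => c * u k) = c * L u,
  forall u, (forall k, 0 <= u k) -> 0 <= L u,
  forall c, L (fun=> c) = c &
  forall u, u @ \oo --> (0 : R) -> L u = 0].
Proof.
have [U [ultraU sub]] := @ultraFilterLemma nat \oo _.
have propU : ProperFilter U by exact: ultra_proper.
(* The value 0 on sequences without a limit along [U] keeps [L] nonnegative on every nonnegative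
   sequence. *)
pose L u : R := if pselect (exists l : R, u @ U --> l) is left _ then lim (u @ U) else 0.
have LE u (l : R) : u @ U --> l -> L u = l.
  move=> ul; rewrite /L; case: pselect => [_|]; last by case; exists l.
  exact: (cvg_lim _ ul).
have cvgL u : bounded_seq u -> u @ U --> L u.
  by move=> /(ultrafilter_cvg ultraU)[l ul]; rewrite (LE _ _ ul).
exists L; split.
- by move=> u v bu bv; apply: LE; apply: cvgD; exact: cvgL.
- by move=> c u bu; apply: LE; apply: cvgMl_tmp; exact: cvgL.
- move=> u u0; rewrite /L; case: pselect => [[l ul]|//].
  apply: limr_ge; first by apply/cvg_ex; exists l.
  by apply: filterS (@filterT _ U _) => k _.
- by move=> c; apply: LE; exact: cvg_cst.
- by move=> u u0; apply: LE; exact: cvg_trans (cvg_app u sub) u0.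
Qed.

End ultralimit.

Section functional01.
Context d (T : measurableType d) (R : realType).

Definition mfun01 (g : T -> R) := measurable_fun setT g /\ forall x, 0 <= g x <= 1.

Lemma mfun01_bmf g : mfun01 g -> bmf g. Proof. by move=> [mg g01]; exact: bmf01. Qed.

(* Iterating [g = (\1_A + g') / 2] with [A = [set x | 1 / 2 <= g x]] expands [g] in binary. *)
Lemma functional01_eq0 (Phi : (T -> R) -> R) (B : R) :
  (forall A, measurable A -> Phi (\1_A) = 0) ->
  (forall A g, measurable A -> mfun01 g ->
    Phi (fun x => 2^-1 * (\1_A x + g x)) = 2^-1 * (Phi (\1_A) + Phi g)) ->
  (forall g, mfun01 g -> `|Phi g| <= B) ->
  forall g, mfun01 g -> Phi g = 0.
Proof.
move=> Phi1 PhiD PhiB.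
have approx m g : mfun01 g -> `|Phi g| <= B / 2 ^+ m.
  elim: m g => [|m IH] g g01; first by rewrite expr0 divr1; exact: PhiB.
  have [mg gb] := g01.
  pose A := [set x | 2^-1 <= g x].
  have mA : measurable A.
    have := mg measurableT `[2^-1, +oo[%classic (measurable_itv _).
    by rewrite setTI; congr measurable; apply/seteqP; split => x /=; rewrite in_itv/= andbT.
  pose h x := 2 * g x - \1_A x.
  have h01 : mfun01 h.
    split; first by apply: measurable_funB; [exact: measurable_funM|exact: measurable_indic].
    move=> x; rewrite /h indicE; have /andP[g0 g1] := gb x.
    have [|] := boolP (x \in A); first by rewrite inE /A /= => ?; apply/andP; split; lra.
    by rewrite notin_setE /A /= => /negP; rewrite -ltNge => ?; apply/andP; split; lra.
  have -> : g = (fun x => 2^-1 * (\1_A x + h x)) by apply/funext => x; rewrite /h; lra.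
  rewrite PhiD// Phi1// add0r normrM gtr0_norm ?invr_gt0// exprS invfM mulrCA.
  by rewrite ler_pM2l ?invr_gt0//; exact: IH.
move=> g g01; apply/eqP; rewrite -normr_le0 leNgt; apply/negP => P0.
have [m Bm] := expr_unbounded (B / `|Phi g|) (ltr1n R 2 : 1 < 2).
move: Bm; rewrite ltr_pdivrMr// mulrC -ltr_pdivrMr ?exprn_gt0//.
by move=> /(le_lt_trans (approx m g g01)); rewrite ltxx.
Qed.

End functional01.

Section weak_limit.
Context d (T : measurableType d) (R : realType) (mu : probability T R).
Variables (phi : nat -> T -> R) (C : R) (L : (nat -> R) -> R).
Hypotheses (bphi : forall k, bmf (phi k)) (phi_bnd : forall k x, 0 <= phi k x <= C).
Hypothesis phi1 : forall k, \int[mu]_x phi k x = 1.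
Hypothesis LD : forall u v, bounded_seq u -> bounded_seq v -> L (fun k => u k + v k) = L u + L v.
Hypothesis LZ : forall c u, bounded_seq u -> L (fun k => c * u k) = c * L u.
Hypothesis L_ge0 : forall u, (forall k, 0 <= u k) -> 0 <= L u.
Hypothesis L_cst : forall c, L (fun=> c) = c.

Let phi_ge0 k x : 0 <= phi k x. Proof. by case/andP: (phi_bnd k x). Qed.
Let phi_leC k x : phi k x <= C. Proof. by case/andP: (phi_bnd k x). Qed.
Let pair (g : T -> R) k := \int[mu]_x (phi k x * g x).

Let bpair_int g k : bmf g -> bmf (fun x => phi k x * g x).
Proof. exact: bmfM. Qed.

Let pair_bounded g : bmf g -> bounded_seq (pair g).
Proof.
move=> bg; have [mg [M gM]] := bg; exists M => k.
have bM (c : R) : bmf (fun x => phi k x * c) by apply: bmfM => //; exact: bmf_cst.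
have pM (c : R) : \int[mu]_x (phi k x * c) = c by rewrite RintZr// phi1 mul1r.
rewrite ler_norml -{1}(pM (- M)) -{2}(pM M); apply/andP; split.
  apply: le_Rint; [exact: bM|exact: bpair_int|move=> x].
  by apply: ler_wpM2l => //; have := gM x; rewrite ler_norml => /andP[].
apply: le_Rint; [exact: bpair_int|exact: bM|move=> x].
by apply: ler_wpM2l => //; have := gM x; rewrite ler_norml => /andP[].
Qed.

Let Lp g := L (pair g).

Let LpD g h : bmf g -> bmf h -> Lp (fun x => g x + h x) = Lp g + Lp h.
Proof.
move=> bg bh; rewrite -LD; [|exact: pair_bounded..]; congr L; apply/funext => k.
rewrite -RintD; [|exact: bpair_int..].
by apply: eq_Rint => x; rewrite mulrDr.
Qed.

Let LpZ c g : bmf g -> Lp (fun x => c * g x) = c * Lp g.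
Proof.
move=> bg; rewrite -LZ; last exact: pair_bounded; congr L; apply/funext => k.
rewrite -RintZ; last exact: bpair_int.
by apply: eq_Rint => x; rewrite mulrCA.
Qed.

Let LpB g h : bmf g -> bmf h -> Lp (fun x => g x - h x) = Lp g - Lp h.
Proof.
move=> bg bh; rewrite -mulN1r -LpZ// -LpD//; last exact: bmfZ.
by congr Lp; apply/funext => x; rewrite mulN1r.
Qed.

Let Lp_sum n (g : nat -> T -> R) : (forall i, bmf (g i)) ->
  Lp (fun x => \sum_(i < n) g i x) = \sum_(i < n) Lp (g i).
Proof.
move=> bg; elim: n => [|n IH].
  rewrite big_ord0 -[RHS](mul0r (Lp (fun=> 0))) -LpZ; last exact: bmf_cst.
  by congr Lp; apply/funext => x; rewrite big_ord0 mul0r.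
rewrite [RHS]big_ord_recr /= -IH -LpD//; last exact: bmf_sum.
by congr Lp; apply/funext => x; rewrite big_ord_recr.
Qed.

Let Lp_ge0 g : (forall x, 0 <= g x) -> 0 <= Lp g.
Proof. by move=> g0; apply: L_ge0 => k; apply: Rintegral_ge0 => x _; rewrite mulr_ge0. Qed.

Let Lp1 : Lp (fun=> 1) = 1.
Proof.
rewrite -[RHS]L_cst; congr L; apply/funext => k.
by rewrite -[RHS](phi1 k); apply: eq_Rint => x; rewrite mulr1.
Qed.

Let Lp_le_Rint g : bmf g -> (forall x, 0 <= g x) -> Lp g <= C * \int[mu]_x g x.
Proof.
move=> bg g0; rewrite -subr_ge0 -[C * _]L_cst -mulN1r -LZ; last exact: pair_bounded.
rewrite -LD; last 2 first.
- by exists `|C * \int[mu]_x g x|.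
- have [M pM] := pair_bounded bg; exists M => k.
  by rewrite mulN1r normrN.
apply: L_ge0 => k; rewrite mulN1r subr_ge0 -RintZ//; apply: le_Rint.
- exact: bpair_int.
- exact: bmfZ.
- by move=> x; apply: ler_wpM2r.
Qed.

Definition weak_limit_set (A : set T) : \bar R := (Lp (\1_A))%:E.

Let nu0 : weak_limit_set set0 = 0%E.
Proof.
rewrite /weak_limit_set; congr (_%:E); rewrite -[RHS](mul0r (Lp (fun=> 0))) -LpZ; last exact: bmf_cst.
by congr Lp; apply/funext => x; rewrite mul0r indic0.
Qed.

Let nu_ge0 A : (0 <= weak_limit_set A)%E.
Proof. by rewrite lee_fin; exact: Lp_ge0. Qed.

Let sum_indic_le (F : nat -> set T) n x : trivIset setT F ->
  \sum_(i < n) \1_(F i) x <= \1_(\bigcup_i F i) x :> R.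
Proof.
move=> tF; have [[m _ Fm]|nF] := pselect ((\bigcup_i F i) x); last first.
  rewrite big1 // => i _; rewrite indicE memNset// => Fi; apply: nF; exists (i : nat) => //.
rewrite [leRHS]indicE mem_set; last by exists m.
apply: (@le_trans _ _ (\sum_(i < n) ((i == m :> nat)%:R))).
  apply: ler_sum => i _; rewrite indicE; have [Fi|] := boolP (x \in F i); last by rewrite ler0n.
  rewrite (_ : (i : nat) = m) ?eqxx//.
  by apply: (tF i m) => //; exists x; split => //; exact: set_mem.
elim: n => [|n IH]; first by rewrite big_ord0.
rewrite big_ord_recr/=; have [nm|] := eqVneq n m; last by rewrite addr0.
rewrite big1 ?add0r// => i _; rewrite -nm; have := ltn_ord i.
by rewrite ltn_neqAle => /andP[/negPf -> _].
Qed.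

(** A limit along an ultrafilter preserves finite additivity only. The domination [Lp g <= C *
    \int[mu]_x g x] supplies the rest: the remainders [g n] have integrals tending to 0. *)
Let nu_sigma_additive : semi_sigma_additive weak_limit_set.
Proof.
move=> F mF tF mUF; set U := \bigcup_n F n in mUF *.
pose g n x : R := \1_U x - \sum_(i < n) \1_(F i) x.
have bF i : bmf (\1_(F i) : T -> R) by exact: bmf_indic.
have bU : bmf (\1_U : T -> R) by exact: bmf_indic.
have bS n : bmf (fun x => \sum_(i < n) \1_(F i) x : R) by exact: (@bmf_sum _ _ _ n (fun i => \1_(F i))).
have bg n : bmf (g n) by exact: bmfB.
have g0 n x : 0 <= g n x by rewrite subr_ge0; exact: sum_indic_le.
have Ig n : \int[mu]_x g n x = fine (mu U) - \sum_(i < n) fine (mu (F i)).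
  rewrite RintB// Rint_indic//; congr (_ - _).
  rewrite (Rint_sum mu n (f := fun i => \1_(F i)))//.
  by apply: eq_bigr => i _; rewrite Rint_indic.
have Lg n : Lp (g n) = Lp (\1_U) - \sum_(i < n) Lp (\1_(F i)).
  by rewrite LpB// (Lp_sum n (g := fun i => \1_(F i))).
have Ig0 : (fun n => C * \int[mu]_x g n x) @ \oo --> 0.
  rewrite -[0](mulr0 C); apply: cvgMl_tmp; rewrite -[0](subrr (fine (mu U))).
  under eq_fun do rewrite Ig; apply: cvgB; first exact: cvg_cst.
  have muU := @measure_semi_sigma_additive _ _ _ mu F mF tF mUF.
  have muUfin : mu U \is a fin_num by exact: fin_num_measure.
  rewrite -[X in _ --> X](fineK muUfin) in muU; move/fine_cvg : muU.
  apply: cvg_trans; apply: near_eq_cvg; near=> n => /=.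
  rewrite big_mkord (eq_bigr (fun i : 'I_n => (fine (mu (F i)))%:E)) ?sumEFin//.
  by move=> i _; rewrite fineK// fin_num_measure.
have Lg0 : (fun n => Lp (g n)) @ \oo --> 0.
  apply: (squeeze_cvgr _ (cvg_cst 0) Ig0); near=> n.
  by rewrite Lp_ge0//= Lp_le_Rint.
rewrite [X in _ --> X](_ : _ = (Lp (\1_U))%:E)//.
apply/fine_cvgP; split; first by near=> n; rewrite sumEFin.
have : (fun n => Lp (\1_U) - Lp (g n)) @ \oo --> Lp (\1_U).
  by rewrite -[X in _ --> X]subr0; apply: cvgB => //; exact: cvg_cst.
apply: cvg_trans; apply: near_eq_cvg; near=> n => /=.
by rewrite sumEFin/= big_mkord Lg subKr.
Unshelve. all: by end_near. Qed.

(** By construction [nu] agrees with the generalized limit on indicators; [functional01_eq0] extends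
    this to functions with values in [0, 1], which include the sections of [G]. *)
Lemma weak_limit : exists nu : {finite_measure set T -> \bar R},
  \int[nu]_x 1 = 1 /\ forall g, mfun01 g -> \int[nu]_x g x = L (fun k => \int[mu]_x (phi k x * g x)).
Proof.
pose meas := isMeasure.Build _ T R weak_limit_set nu0 nu_ge0 nu_sigma_additive.
have nu_fin : fin_num_fun weak_limit_set by [].
pose nu1 : {measure set T -> \bar R} := HB.pack weak_limit_set meas.
pose fin := Measure_isFinite.Build _ T R nu1 nu_fin.
pose nu : {finite_measure set T -> \bar R} := HB.pack weak_limit_set meas fin.
exists nu.
have nuE A : measurable A -> \int[nu]_x (\1_A x) = Lp (\1_A).
  by move=> mA; rewrite Rint_indic.
have nu1E : \int[nu]_x 1 = 1.
  rewrite -[RHS]Lp1 (_ : (fun=> 1) = \1_(@setT T)); last by apply/funext => x; rewrite indicT.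
  by rewrite -nuE//; apply: eq_Rint => x; rewrite indicT.
split => // g g01; apply/eqP; rewrite -subr_eq0; apply/eqP; move: g g01.
apply: (@functional01_eq0 _ _ _ (fun g => \int[nu]_x g x - Lp g) 1).
- by move=> A mA; rewrite nuE// subrr.
- move=> A g mA g01; have bg := mfun01_bmf g01; have bA : bmf (\1_A : T -> R) by exact: bmf_indic.
  rewrite LpZ; last exact: bmfD.
  rewrite LpD// RintZ; last exact: bmfD.
  by rewrite RintD//; lra.
- move=> g g01; have bg := mfun01_bmf g01; have [mg gb] := g01.
  have : 0 <= \int[nu]_x g x <= 1.
    rewrite Rintegral_ge0/=; last by move=> x _; case/andP: (gb x).
    by rewrite -nu1E; apply: le_Rint => //; [exact: bmf_cst|move=> x; case/andP: (gb x)].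
  have : 0 <= Lp g <= 1.
    rewrite Lp_ge0/=; last by move=> x; case/andP: (gb x).
    rewrite -subr_ge0 -Lp1 -LpB//; last exact: bmf_cst.
    by apply: Lp_ge0 => x; rewrite subr_ge0; case/andP: (gb x).
  by rewrite ler_norml; lra.
Qed.

End weak_limit.

(** * The eigenfunction obtained from truncated resolvents *)

Section perron.
Context d (T : measurableType d) (R : realType) (mu : probability T R).
Variable G : digraphon T R.
Hypotheses (iG : irreducible mu G).
Local Notation op := (lop mu G).
Local Notation t := (iterates mu G).
Local Notation a := (mass mu G).
Let bG := bmf_digraphon G.

(** If [f y = 0], then the integral [op f y] vanishes, so almost no edge enters [y] from the set
    where [f] is positive. Hence almost no edge leaves this set. *)
Lemma eigenfunction_gt0 (f : T -> R) (r : R) : bmf f -> (forall x, 0 <= f x) ->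
  {ae mu, forall x, op f x = r * f x} -> ~ {ae mu, forall x, f x = 0} ->
  {ae mu, forall x, 0 < f x}.
Proof.
move=> bf f0 fE nf; pose A := [set x | 0 < f x].
have mA : measurable A by apply: measurable_pos_set; case: bf.
have [|H|//] := iG mA.
  apply: (@ae_swap _ _ _ _ _ mu mu (fun y x => A x -> ~ A y -> G (x, y) = 0)).
    apply: (mset_comp (h := fun z : T * T => (z.2, z.1)) _ (mset_edge G mA)).
    exact: measurable_fun_pair.
  apply: filterS fE => y fy; have [fy0|fy0] := eqVneq (f y) 0; last first.
    by apply: aeW => x _; case; rewrite /A /= lt_def fy0 f0.
  rewrite fy0 mulr0 in fy.
  have h0 x : 0 <= f x * G (x, y) by rewrite mulr_ge0 ?digraphon_ge0.
  have := (Rint_eq0P mu (bmf_lop_integrand y bG bf) h0).1 fy.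
  apply: filterS => x /eqP; rewrite mulf_eq0 => /orP[/eqP fx|/eqP //].
  by rewrite /A /= fx ltxx.
case: nf; apply: filterS H => x nA; apply/eqP/negP => /negP fx.
by apply: nA; rewrite /A /= lt_def fx f0.
Qed.

Hypothesis Hmu : atomless mu.

Let bt n : bmf (t n). Proof. exact: bmf_iterates. Qed.
Let t_ge0 n x : 0 <= t n x. Proof. by apply: iterates_ge0; exact: digraphon_ge0. Qed.

Section truncated_resolvent.
Variables (w : R) (N : nat).
Hypotheses (w1 : 1 <= w) (wa : forall n, 1 <= w ^+ n.+1 * a n) (N0 : (0 < N)%N).

Let w0 : 0 < w. Proof. exact: lt_le_trans w1. Qed.
Let wn0 n : 0 <= w ^+ n. Proof. by rewrite exprn_ge0// ltW. Qed.

Definition resolvent_sum x := \sum_(n < N) w ^+ n * t n x.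
Definition resolvent_mass := \sum_(n < N) w ^+ n * a n.
Local Notation F := resolvent_sum.
Local Notation s := resolvent_mass.

Let bterm n : bmf (fun x => w ^+ n * t n x). Proof. exact: bmfZ. Qed.

Lemma bmf_resolvent_sum : bmf F.
Proof. exact: (@bmf_sum _ _ _ N (fun n x => w ^+ n * t n x)). Qed.

Lemma resolvent_sum_ge0 x : 0 <= F x.
Proof. by apply: sumr_ge0 => n _; rewrite mulr_ge0. Qed.

Lemma Rint_resolvent_sum : \int[mu]_x F x = s.
Proof.
rewrite (@Rint_sum _ _ _ mu N (fun n x => w ^+ n * t n x))//.
by apply: eq_bigr => n _; rewrite RintZ.
Qed.

Lemma resolvent_mass_ge : N%:R / w <= s.
Proof.
rewrite (_ : N%:R / w = \sum_(n < N) w^-1); last by rewrite sumr_const card_ord mulr_natl.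
apply: ler_sum => n _; rewrite -[w^-1]mul1r ler_pdivrMr// mulrAC -exprSr.
exact: wa.
Qed.

Lemma resolvent_mass_gt0 : 0 < s.
Proof. by rewrite (lt_le_trans _ resolvent_mass_ge)// divr_gt0// ltr0n. Qed.

(** A telescoping sum. After division by [resolvent_mass] both error terms are small: the mass is at
    least [N%:R / w], and [critical_scale] provides [N] with a negligible last term. *)
Lemma resolvent_identity x : w * op F x = F x - 1 + w ^+ N * t N x.
Proof.
rewrite (@lop_sum _ _ _ mu G N (fun n x => w ^+ n * t n x))//.
transitivity (\sum_(n < N) w ^+ n.+1 * t n.+1 x).
  by rewrite mulr_sumr; apply: eq_bigr => n _; rewrite lopZ// mulrA -exprS.
rewrite /F; elim: (N) => [|n IH]; first by rewrite !big_ord0 expr0 /t/=; lra.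
by rewrite big_ord_recr IH [in RHS]big_ord_recr/=; lra.
Qed.

(** The term [n = 0] is 1, which is at most the mass since [mass 0 = 1]; the others are bounded
    through [t n.+1 <= mass n] by [w] times the mass. *)
Lemma resolvent_sum_le x : F x <= (1 + w) * s.
Proof.
have tle n : t n.+1 x <= a n by have := iterates_le mu G n 0 x; rewrite addn0 mulr1.
rewrite /F /s; move: N0; case: (N) => // n _.
have term_ge0 (i : nat) : 0 <= w ^+ i * a i by rewrite mulr_ge0 ?mass_ge0.
rewrite big_ord_recl mulrDl mul1r lerD//.
  rewrite expr0 mul1r [leLHS]/= big_ord_recl mass0 expr0 mul1r lerDl.
  by apply: sumr_ge0 => i _; exact: term_ge0.
rewrite [in leRHS]big_ord_recr mulrDr/= ler_wpDr//; first by rewrite mulr_ge0// ltW.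
rewrite mulr_sumr; apply: ler_sum => i _.
by rewrite mulrA -exprS; apply: ler_wpM2l => //; exact: tle.
Qed.

End truncated_resolvent.

(* The eigenfunction is [fun x => w * \int[nu]_y G (y, x)] for a weak limit [nu] of the
   normalized truncated resolvents at the critical [w]. *)
Lemma perron : exists (r : R) (f : T -> R), [/\ 0 < r, bmf f, forall x, 0 <= f x,
  forall x, op f x = r * f x & {ae mu, forall x, 0 < f x}].
Proof.
have [c c01 ac] := mass_geometric Hmu iG.
have [w [w1 wa wN]] := critical_scale c01 ac (mass0 mu G) (mass_submul mu G).
have w0 : 0 < w by exact: lt_le_trans w1.
have /choice[N NP] : forall k, exists N, (k.+1 <= N)%N /\
    w ^+ N * a N <= k.+1%:R^-1 * resolvent_mass w N.
  move=> k; have [|N] := wN k.+1%:R^-1 k.+1; first by rewrite invr_gt0.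
  by exists N.
have kN k : (k < N k)%N by case: (NP k).
have N_gt0 k : (0 < N k)%N by exact: leq_ltn_trans (kN k).
pose s k := resolvent_mass w (N k).
have s0 k : 0 < s k by exact: resolvent_mass_gt0.
pose phi k x := (s k)^-1 * resolvent_sum w (N k) x.
have bphi k : bmf (phi k) by apply: bmfZ; exact: bmf_resolvent_sum.
have phib k x : 0 <= phi k x <= 1 + w.
  rewrite mulr_ge0 ?invr_ge0 ?(ltW (s0 k)) ?resolvent_sum_ge0//=.
  by rewrite /phi mulrC ler_pdivrMr// resolvent_sum_le.
have phi1 k : \int[mu]_x phi k x = 1.
  by rewrite RintZ ?Rint_resolvent_sum ?mulVf ?gt_eqF//; exact: bmf_resolvent_sum.
have [L [LD LZ L_ge0 L_cst L0]] := ultralimit R.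
have [nu [nu1 nuE]] := weak_limit bphi phib phi1 LD LZ L_ge0 L_cst.
pose f x := w * \int[nu]_y G (y, x).
have bf : bmf f by apply: bmfZ; exact: (bmf_Rint2 nu bG).
have f0 x : 0 <= f x.
  by rewrite mulr_ge0 ?(ltW w0)//; apply: Rintegral_ge0 => y _; exact: digraphon_ge0.
(* Testing the resolvent identity against [g] and passing to the limit shows that [nu] has density
   [f] with respect to [mu]. *)
have nuf g : mfun01 g -> \int[nu]_x g x = \int[mu]_x (f x * g x).
  move=> g01; have bg := mfun01_bmf g01; have [_ gb] := g01.
  pose g' y := \int[mu]_x (G (y, x) * g x).
  have bH : bmf (fun z : T * T => G z * g z.2) by apply: bmfM => //; exact: bmf_snd.
  have bg' : bmf g' by have := bmf_Rint mu bH; congr bmf.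
  have g'01 : mfun01 g'.
    split; first by case: bg'.
    move=> y; rewrite /g' Rintegral_ge0/=; last first.
      by move=> x _; rewrite mulr_ge0 ?digraphon_ge0//; case/andP: (gb x).
    apply: Rint_le1; first by apply: bmfM => //; exact: bmf_pair.
    by move=> x; have /andP[? ?] := gb x; rewrite mulr_ile1 ?digraphon_ge0 ?digraphon_le1.
  pose e k := (s k)^-1 * \int[mu]_x ((1 - w ^+ N k * t (N k) x) * g x).
  have b1t k : bmf (fun x => 1 - w ^+ N k * t (N k) x) by apply: bmfB; [exact: bmf_cst|exact: bmfZ].
  have pairE k : \int[mu]_x (phi k x * g x) = w * \int[mu]_x (phi k x * g' x) + e k.
    rewrite -(lop_adjoint mu bG (bphi k) bg).
    have bo : bmf (op (phi k)) by exact: bmf_lop.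
    rewrite -RintZ; last exact: bmfM.
    rewrite /e -RintZ; last exact: bmfM.
    rewrite -RintD; [|by apply: bmfZ; exact: bmfM..].
    apply: eq_Rint => x; rewrite lopZ//; last exact: bmf_resolvent_sum.
    have := resolvent_identity w (N k) x; rewrite /phi.
    move: (op _ x) (resolvent_sum w (N k) x) => u v uv.
    have -> : v = w * u + (1 - w ^+ N k * t (N k) x) by lra.
    by ring.
  (* The constant term contributes [w / k.+1], because [s k] is at least [k.+1 / w]; the last
     iterate contributes [1 / k.+1], by the choice of [N k]. *)
  have e_le k : `|e k| <= (1 + w) / k.+1%:R.
    have sk : k.+1%:R / w <= s k.
      apply: le_trans (resolvent_mass_ge (N k) w1 wa).
      by rewrite ler_pM2r ?invr_gt0// ler_nat.
    have k0 : 0 < k.+1%:R :> R by [].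
    rewrite /e normrM gtr0_norm ?invr_gt0// mulrC ler_pdivrMr//.
    have -> : \int[mu]_x ((1 - w ^+ N k * t (N k) x) * g x) =
        \int[mu]_x g x - w ^+ N k * \int[mu]_x (t (N k) x * g x).
      rewrite -RintZ; last exact: bmfM.
      rewrite -RintB//; last by apply: bmfZ; exact: bmfM.
      by apply: eq_Rint => x; rewrite mulrBl mul1r mulrA.
    have i0 : 0 <= \int[mu]_x g x by apply: Rintegral_ge0 => x _; case/andP: (gb x).
    have i1 : \int[mu]_x g x <= 1 by apply: Rint_le1 => // x; case/andP: (gb x).
    have j0 : 0 <= \int[mu]_x (t (N k) x * g x).
      by apply: Rintegral_ge0 => x _; rewrite mulr_ge0//; case/andP: (gb x).
    have j1 : \int[mu]_x (t (N k) x * g x) <= a (N k).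
      apply: le_Rint => //; first exact: bmfM.
      by move=> x; rewrite ler_piMr//; case/andP: (gb x).
    have [_ wk] := NP k; rewrite -/(s k) in wk.
    have wj0 : 0 <= w ^+ N k * \int[mu]_x (t (N k) x * g x) by rewrite mulr_ge0// exprn_ge0// ltW.
    have wj1 : w ^+ N k * \int[mu]_x (t (N k) x * g x) <= k.+1%:R^-1 * s k.
      by apply: le_trans wk; apply: ler_wpM2l => //; rewrite exprn_ge0// ltW.
    have ws : 1 <= w / k.+1%:R * s k.
      by rewrite mulrAC ler_pdivlMr// mul1r mulrC -ler_pdivrMr.
    rewrite mulrDl mul1r mulrDl ler_norml; move: i0 i1 wj0 wj1 ws.
    move: (_^-1 * s k) (w / _ * s k) (w ^+ N k * _) (\int[mu]_x g x) => p q y z.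
    by move=> *; apply/andP; split; lra.
  have e0 : e @ \oo --> (0 : R).
    have E0 : (fun k => (1 + w) / k.+1%:R) @ \oo --> (0 : R).
      rewrite -[X in _ --> X](mulr0 (1 + w)); apply: cvgMl_tmp; exact: cvg_harmonic.
    apply/norm_cvg0P; apply: (squeeze_cvgr _ (cvg_cst 0) E0); near=> k.
    by rewrite normr_ge0 e_le.
  have pb h : mfun01 h -> bounded_seq (fun k => \int[mu]_x (phi k x * h x)).
    move=> h01; have bh := mfun01_bmf h01; have [_ hb] := h01; exists 1 => k.
    rewrite ger0_norm; last first.
      by apply: Rintegral_ge0 => x _; rewrite mulr_ge0//; [case/andP: (phib k x)|case/andP: (hb x)].
    rewrite -(phi1 k); apply: le_Rint => //; first exact: bmfM.
    by move=> x; rewrite ler_piMr//; [case/andP: (phib k x)|case/andP: (hb x)].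
  have eb : bounded_seq e.
    exists (1 + w) => k; rewrite (le_trans (e_le k))// ler_piMr ?invf_le1 ?ler1n//; lra.
  rewrite nuE//; under eq_fun do rewrite pairE.
  rewrite LD//; last first.
    have [M gM] := pb _ g'01; exists (w * M) => k.
    by rewrite normrM gtr0_norm// ler_pM2l.
  rewrite (L0 _ e0) addr0 LZ; last exact: pb.
  rewrite -nuE// (Rint_fubini nu mu bH) -RintZ; last exact: (bmf_Rint2 nu bH).
  apply: eq_Rint => x /=; rewrite RintZr ?mulrA//; exact: bmf_pair2.
(* Take [g = G(_, x)] in [nuf]: the equation holds at every [x], since [f x] is itself defined by an
   integral of this section. *)
have opf x : op f x = w^-1 * f x.
  rewrite /f mulrA mulVf ?gt_eqF// mul1r nuf//; split; last by move=> y; exact: digraphon_bounds.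
  by case: (bmf_pair2 x bG).
exists w^-1, f; split => //; first by rewrite invr_gt0.
apply: (eigenfunction_gt0 bf f0 (aeW _ opf)) => /(Rint_eq0P mu bf f0) If.
have := nuf (fun=> 1); rewrite nu1 => /(_ _) H1.
have : 1 = \int[mu]_x (f x * 1) by apply: H1; split => // x; rewrite ler01 lexx.
by under eq_Rint do rewrite mulr1; rewrite If => /eqP; rewrite oner_eq0.
Unshelve. all: by end_near. Qed.

End perron.

(** * Peripheral eigenvalues *)

Section complex_modulus.
Variable R : realType.
Implicit Types z : R[i].
Local Notation normc := (@Normc.normc R).

Lemma normcE_sqrt z : normc z = Num.sqrt (complex.Re z ^+ 2 + complex.Im z ^+ 2).
Proof. by case: z. Qed.

Lemma normc_ge0 z : 0 <= normc z. Proof. by rewrite normcE_sqrt sqrtr_ge0. Qed.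

Lemma normc_eq0 z : (normc z == 0) = (z == 0).
Proof.
apply/eqP/eqP => [|->]; first exact: Normc.eq0_normc.
exact: Normc.normc0.
Qed.

Lemma Re_le_normc z : complex.Re z <= normc z.
Proof.
case: z => a b /=; rewrite (le_trans (ler_norm a))// -sqrtr_sqr ler_wsqrtr//.
by rewrite lerDl sqr_ge0.
Qed.

Lemma normcR (x : R) : 0 <= x -> normc x%:C%C = x.
Proof. by move=> x0; rewrite /= expr0n /= addr0 sqrtr_sqr ger0_norm. Qed.

Lemma Re_eq_normc z : complex.Re z = normc z -> z = (normc z)%:C%C.
Proof.
case: z => a b /= e; have : a ^+ 2 = a ^+ 2 + b ^+ 2.
  by rewrite {1}e sqr_sqrtr// addr_ge0 ?sqr_ge0.
move/eqP; rewrite -subr_eq0 opprD addrA subrr sub0r oppr_eq0 sqrf_eq0 => /eqP b0.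
by rewrite -e b0.
Qed.

Lemma normcX z n : normc (z ^+ n) = normc z ^+ n.
Proof.
elim: n => [|n IH]; first by rewrite !expr0 -(@normcR 1).
by rewrite !exprS Normc.normcM IH.
Qed.

Lemma Re_mulc z z' : complex.Re (z * z') =
  complex.Re z * complex.Re z' - complex.Im z * complex.Im z'.
Proof. by case: z z' => a b [c d]. Qed.

Lemma Im_mulc z z' : complex.Im (z * z') =
  complex.Re z * complex.Im z' + complex.Im z * complex.Re z'.
Proof. by case: z z' => a b [c d]. Qed.

Lemma complex_ext z z' : complex.Re z = complex.Re z' -> complex.Im z = complex.Im z' -> z = z'.
Proof. by case: z z' => a b [c d] /= -> ->. Qed.

End complex_modulus.

(** * Bounded representatives of eigenfunctions *)

Section eigenfunctions.
Context d (T : measurableType d) (R : realType) (mu : probability T R).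
Variable G : digraphon T R.
Local Notation op := (lop mu G).
Local Notation opc := (digraphon_op mu G).
Local Notation normc := (@Normc.normc R).
Let bG := bmf_digraphon G.

Definition cbmf (g : T -> R[i]) :=
  bmf (fun x => complex.Re (g x)) /\ bmf (fun x => complex.Im (g x)).

Lemma Re_opc (f : T -> R[i]) x : complex.Re (opc f x) = op (fun y => complex.Re (f y)) x.
Proof. by apply: eq_Rint => y; case: (f y) => a b /=; rewrite mulr0 subr0. Qed.

Lemma Im_opc (f : T -> R[i]) x : complex.Im (opc f x) = op (fun y => complex.Im (f y)) x.
Proof. by apply: eq_Rint => y; case: (f y) => a b /=; rewrite mulr0 add0r. Qed.

(** The bound is the $L^1$ norm of [u], as [G] is at most 1. Measurability comes from Fubini's
    theorem for the integrable function [F], since [u] may be unbounded. *)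
Lemma bmf_op_integrable (u : T -> R) : mu.-integrable setT (EFin \o u) -> bmf (op u).
Proof.
move=> iu; have mu_ : measurable_fun setT u by exact/measurable_EFinP/(measurable_int mu).
pose F (z : T * T) := u z.1 * G z.
have mF : measurable_fun setT F.
  by apply: measurable_funM; [exact: measurableT_comp|exact: digraphon_measurable].
have mEF : measurable_fun setT (EFin \o F) by exact/measurable_EFinP.
have uG y x : `|u y * G (y, x)| <= `|u y|.
  by rewrite normrM (ger0_norm (digraphon_ge0 _ _)) ler_piMr// digraphon_le1.
have iabs : (\int[mu]_y `|(u y)%:E| < +oo)%E by case/integrableP : iu.
have iF : (prod_prob mu mu).-integrable setT (EFin \o F).
  apply/(integrable12ltyP mu mu mEF); apply: le_lt_trans iabs.
  apply: ge0_le_integral => //.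
  - by move=> y _; exact: integral_ge0.
  - apply: (measurable_fun_fubini_tonelli_F (m2 := mu) (abse \o (EFin \o F))) => //.
      exact: measurableT_comp.
    by move=> z; exact: abse_ge0.
  - by move: mu_ => /measurable_EFinP; exact: measurableT_comp.
  - move=> y _; rewrite -[leRHS]mule1 -[X in (_ * X)%E](probability_setT mu) -integral_cst//.
    apply: ge0_le_integral => //.
    + by apply: measurableT_comp => //; apply/measurable_EFinP; apply: (measurable_fun_pair2 _ mF).
    + by move=> x _; rewrite lee_fin uG.
split.
  apply: (measurableT_comp (fine_measurable measurableT)).
  exact: (measurable_fubini_G iF).
exists (\int[mu]_y `|u y|) => x.
have muG : measurable_fun setT (fun y => u y * G (y, x)).
  by apply: (measurable_fun_pair1 _ mF).
have iuG : mu.-integrable setT (EFin \o (fun y => u y * G (y, x))).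
  apply: (le_integrable measurableT _ _ iu); first exact/measurable_EFinP.
  by move=> y _; rewrite lee_fin uG.
apply: (le_trans (le_normr_Rintegral measurableT iuG)).
apply: le_Rintegral => //.
- exact: integrable_norm.
- exact: integrable_norm.
Qed.

Lemma cL2_integrable (f : T -> R[i]) : cL2 mu f ->
  mu.-integrable setT (EFin \o (fun x => complex.Re (f x))) /\
  mu.-integrable setT (EFin \o (fun x => complex.Im (f x))).
Proof.
have muT : mu setT \is a fin_num by exact: fin_num_measure.
by move=> [fR fI]; split; apply/Lfun1_integrable; exact: Lfun_subset12.
Qed.

Lemma bmf_cL2 (f : T -> R[i]) : cbmf f -> cL2 mu f.
Proof.
suff L2 (u : T -> R) : bmf u -> u \in Lfun mu 2%:E by move=> [? ?]; split; exact: L2.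
move=> [mu_ [M uM]]; rewrite inE/=; apply/andP; split; rewrite inE//=.
rewrite /finite_norm unlock poweR_lty//.
have : (\int[mu]_x ((`|M| `^ 2)%:E) < +oo)%E.
  by rewrite integral_cst// [X in (_ * X)%E](probability_setT mu) mule1 ltry.
apply: le_lt_trans; apply: ge0_le_integral => //=.
- apply/measurable_EFinP; apply: (measurableT_comp (measurable_powR _)).
  exact: measurableT_comp.
- move=> x _; rewrite lee_fin ge0_ler_powR//.
  by rewrite (le_trans (uM x))// ler_norm.
Qed.

Lemma opc_ae_eq (f g : T -> R[i]) x : cL2 mu f -> cbmf g ->
  {ae mu, forall y, f y = g y} -> opc f x = opc g x.
Proof.
move=> /cL2_integrable[iR iI] [[mgR _] [mgI _]] fg.
have mG : measurable_fun setT (fun y => G (y, x)) by case: (bmf_pair2 x bG).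
have mfR := measurable_int _ iR; have mfI := measurable_int _ iI.
apply: complex_ext; rewrite ?Re_opc ?Im_opc; apply: ae_eq_Rint.
- by apply: measurable_funM => //; exact/measurable_EFinP.
- exact: measurable_funM.
- by apply: filterS fg => y ->.
- by apply: measurable_funM => //; exact/measurable_EFinP.
- exact: measurable_funM.
- by apply: filterS fg => y ->.
Qed.

(** The representative [l^-1 * opc f] is bounded and satisfies the equation at every point, because
    the operator ignores changes on null sets. *)
Lemma eigenvalue_bounded (l : R[i]) : is_eigenvalue mu G l -> l != 0 ->
  exists g : T -> R[i], [/\ cbmf g, ~ {ae mu, forall x, g x = 0} &
    forall x, opc g x = l * g x].
Proof.
move=> [f [f2 f0 fl]] l0; have [iR iI] := cL2_integrable f2.
pose g x := l^-1 * opc f x.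
have bR := bmf_op_integrable iR; have bI := bmf_op_integrable iI.
have bg : cbmf g.
  split.
    have -> : (fun x => complex.Re (g x)) = (fun x => complex.Re l^-1 * op (fun y => complex.Re (f y)) x
       - complex.Im l^-1 * op (fun y => complex.Im (f y)) x).
      by apply/funext => x; rewrite Re_mulc Re_opc Im_opc.
    by apply: bmfB; exact: bmfZ.
  have -> : (fun x => complex.Im (g x)) = (fun x => complex.Re l^-1 * op (fun y => complex.Im (f y)) x
     + complex.Im l^-1 * op (fun y => complex.Re (f y)) x).
    by apply/funext => x; rewrite Im_mulc Re_opc Im_opc.
  by apply: bmfD; exact: bmfZ.
have fg : {ae mu, forall x, f x = g x}.
  by apply: filterS fl => x fx; rewrite /g fx mulKf.
exists g; split => //.
  by move=> g0; apply: f0; apply: filterS2 fg g0 => x -> .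
by move=> x; rewrite -(opc_ae_eq x f2 bg fg) /g mulVKf.
Qed.

End eigenfunctions.

(** * Equality in the triangle inequality and transport of phases *)

Section peripheral.
Context d (T : measurableType d) (R : realType) (mu : probability T R).
Variable G : digraphon T R.
Hypotheses (Hmu : atomless mu) (iG : irreducible mu G).
Local Notation op := (lop mu G).
Local Notation opc := (digraphon_op mu G).
Local Notation normc := (@Normc.normc R).
Local Notation pw := (pw mu G).
Let bG := bmf_digraphon G.

Lemma bmf_normc (g : T -> R[i]) : cbmf g -> bmf (fun x => normc (g x)).
Proof.
move=> [[mR [M RM]] [mI [N IN]]]; split.
  have -> : (fun x => normc (g x)) =
      (fun x => Num.sqrt (complex.Re (g x) ^+ 2 + complex.Im (g x) ^+ 2)).
    by apply/funext => x; rewrite normcE_sqrt.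
  have ms : measurable_fun setT (@Num.sqrt R).
    by apply: continuous_measurable_fun; exact: sqrt_continuous.
  apply: (measurableT_comp ms).
  by apply: measurable_funD; exact: measurable_funX.
exists (M + N) => x; rewrite ger0_norm ?normc_ge0// (le_trans _ (lerD (RM x) (IN x)))//.
rewrite normcE_sqrt -[leRHS]ger0_norm ?addr_ge0// -sqrtr_sqr ler_wsqrtr//.
rewrite sqrrD !real_normK ?num_real//.
have := mulr_ge0 (normr_ge0 (complex.Re (g x))) (normr_ge0 (complex.Im (g x))).
by rewrite mulr2n; lra.
Qed.

Lemma Rint_Re_mul (c : R[i]) (g : T -> R[i]) x : cbmf g ->
  \int[mu]_y (complex.Re (c * g y) * G (y, x)) = complex.Re (c * opc g x).
Proof.
move=> [bR bI]; rewrite Re_mulc Re_opc Im_opc -!RintZ; [|exact: bmf_lop_integrand..].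
rewrite -RintB; [|by apply: bmfZ; exact: bmf_lop_integrand..].
by apply: eq_Rint => y; rewrite Re_mulc; ring.
Qed.

Lemma bmf_Re_mul (c : R[i]) (g : T -> R[i]) : cbmf g -> bmf (fun y => complex.Re (c * g y)).
Proof.
move=> [bR bI]; have -> : (fun y => complex.Re (c * g y)) =
    (fun y => complex.Re c * complex.Re (g y) - complex.Im c * complex.Im (g y)).
  by apply/funext => y; rewrite Re_mulc.
by apply: bmfB; exact: bmfZ.
Qed.

Definition phase (z : R[i]) : R[i] := z / (normc z)%:C%C.

Lemma normc_phase z : z != 0 -> normc (phase z) = 1.
Proof.
move=> z0; rewrite Normc.normcM Normc.normcV normcR ?normc_ge0// mulfV//.
by rewrite normc_eq0.
Qed.

Lemma phase_mul z : phase z * (normc z)%:C%C = z.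
Proof.
have [->|z0] := eqVneq z 0; first by rewrite /phase !mul0r.
have nz : (normc z)%:C%C != 0 :> R[i] by rewrite (inj_eq (@complexI R) _ 0) normc_eq0.
by rewrite /phase divfK.
Qed.

Lemma phase_invM z : z != 0 -> (phase z)^-1 * z = (normc z)%:C%C.
Proof.
move=> z0; rewrite -{2}(phase_mul z) mulKf//.
by rewrite -normc_eq0 normc_phase// oner_eq0.
Qed.

Section eigenpair.
Variables (l : R[i]) (g : T -> R[i]).
Hypotheses (bg : cbmf g) (gl : forall x, opc g x = l * g x).
Let m x := normc (g x).
Let bm : bmf m. Proof. exact: bmf_normc. Qed.
Let m_ge0 x : 0 <= m x. Proof. exact: normc_ge0. Qed.

(** Rotating by the phase of [l * g x] writes the gap in the triangle inequality as an integral of a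
    nonnegative function. *)
Let deficit x : l * g x != 0 ->
  op m x - normc l * m x =
  \int[mu]_y ((m y - complex.Re ((phase (l * g x))^-1 * g y)) * G (y, x)).
Proof.
move=> lg0; have -> : normc l * m x = complex.Re ((phase (l * g x))^-1 * opc g x).
  by rewrite gl phase_invM//= -Normc.normcM.
rewrite -Rint_Re_mul// -RintB.
- by apply: eq_Rint => y; rewrite mulrBl.
- exact: bmf_lop_integrand.
- by apply: bmf_lop_integrand => //; exact: bmf_Re_mul.
Qed.

Let deficit_integrand_ge0 c y : normc c = 1 -> 0 <= m y - complex.Re (c^-1 * g y).
Proof.
move=> c1; rewrite subr_ge0 (le_trans (Re_le_normc _))//.
by rewrite Normc.normcM Normc.normcV c1 invr1 mul1r.
Qed.

Lemma modulus_le_op x : normc l * m x <= op m x.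
Proof.
have [lg0|lg0] := eqVneq (l * g x) 0.
  rewrite -Normc.normcM lg0 -[leLHS]/(normc 0) Normc.normc0.
  by apply: lop_ge0 => // z; exact: digraphon_ge0.
rewrite -subr_ge0 deficit//; apply: Rintegral_ge0 => y _.
by rewrite mulr_ge0 ?digraphon_ge0 ?deficit_integrand_ge0// normc_phase.
Qed.

(** When the gap is zero, so is its integrand: at almost every in-neighbour [y] of [x] the rotated
    value of [g y] equals its modulus. *)
Lemma phase_transport x : l * g x != 0 -> op m x = normc l * m x ->
  {ae mu, forall y, 0 < G (y, x) -> g y = phase (l * g x) * (m y)%:C%C}.
Proof.
move=> lg0 e; have nphase := normc_phase lg0.
have phase0 : phase (l * g x) != 0 by rewrite -normc_eq0 nphase oner_eq0.
have := deficit lg0; rewrite e subrr => /esym.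
move=> /(Rint_eq0P mu _ _) H; have {}H : {ae mu, forall y,
    (m y - complex.Re ((phase (l * g x))^-1 * g y)) * G (y, x) = 0}.
  apply: H.
    by apply: bmf_lop_integrand => //; apply: bmfB => //; exact: bmf_Re_mul.
  by move=> y; rewrite mulr_ge0 ?digraphon_ge0 ?deficit_integrand_ge0.
apply: filterS H => y /eqP; rewrite mulf_eq0 => /orP[|/eqP ->]; last by rewrite ltxx.
rewrite subr_eq0 => /eqP my _.
have /Re_eq_normc E : complex.Re ((phase (l * g x))^-1 * g y) =
    normc ((phase (l * g x))^-1 * g y).
  by rewrite Normc.normcM Normc.normcV nphase invr1 mul1r -my.
rewrite Normc.normcM Normc.normcV nphase invr1 mul1r in E.
by rewrite -E mulVKf.
Qed.

End eigenpair.

Section right_perron.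
Variables (r : R) (h : T -> R).
Hypotheses (bh : bmf h) (h_ge0 : forall x, 0 <= h x) (h_gt0 : {ae mu, forall x, 0 < h x}).
Hypothesis hr : forall y, \int[mu]_x (G (y, x) * h x) = r * h y.

Lemma Rint_op_right f : bmf f -> \int[mu]_x (op f x * h x) = r * \int[mu]_x (f x * h x).
Proof.
move=> bf; rewrite lop_adjoint// -RintZ; last exact: bmfM.
by apply: eq_Rint => y; rewrite hr mulrCA.
Qed.

Lemma Rint_right_gt0 f : bmf f -> (forall x, 0 <= f x) -> ~ {ae mu, forall x, f x = 0} ->
  0 < \int[mu]_x (f x * h x).
Proof.
move=> bf f0 nf; apply/Rint_gt0P; [exact: bmfM|by move=> x; rewrite mulr_ge0|].
move=> H; apply: nf; apply: filterS2 H h_gt0 => x /eqP; rewrite mulf_eq0 => /orP[/eqP //|/eqP ->].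
by rewrite ltxx.
Qed.

(** Integrate [normc l * m <= op m] against the right eigenfunction [h]; the right-hand side becomes
    [r] times the positive integral of [m * h]. *)
Lemma eigenvalue_le (l : R[i]) : 0 <= r -> is_eigenvalue mu G l -> normc l <= r.
Proof.
move=> r0 el; have [->|l0] := eqVneq l 0; first by rewrite -[normc 0]/(normc 0) Normc.normc0.
have [g [bg g0 gl]] := eigenvalue_bounded el l0.
have bm := bmf_normc bg; set m := fun x => normc (g x) in bm.
have m0 x : 0 <= m x by exact: normc_ge0.
have I0 : 0 < \int[mu]_x (m x * h x).
  apply: Rint_right_gt0 => // H; apply: g0; apply: filterS H => x /eqP.
  by rewrite normc_eq0 => /eqP.
rewrite -(ler_pM2r I0) -Rint_op_right// -RintZ; last exact: bmfM.
apply: le_Rint; [by apply: bmfZ; exact: bmfM|by apply: bmfM => //; exact: bmf_lop|].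
by move=> x; rewrite mulrA ler_wpM2r//; exact: modulus_le_op.
Qed.

(* In the case of equality [|g|] is a Perron eigenfunction, so the phase of [g] is multiplied
   by the fixed number [l / r] along almost every edge. *)
Lemma peripheral_phase (l : R[i]) : 0 < r -> is_eigenvalue mu G l -> normc l = r ->
  exists u : T -> R[i], {ae mu, forall x, u x != 0} /\
  {ae mu, forall y, {ae mu, forall x, forall k, 0 < pw k (y, x) ->
     u y = (l / r%:C%C) ^+ k.+1 * u x}}.
Proof.
move=> r0 el lr; have l0 : l != 0 by rewrite -normc_eq0 lr gt_eqF.
have [g [bg g0 gl]] := eigenvalue_bounded el l0.
have bm := bmf_normc bg; set m := fun x => normc (g x) in bm.
have m0 x : 0 <= m x by exact: normc_ge0.
have bo : bmf (op m) by exact: bmf_lop.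
(* The nonnegative function [op m - r * m] has integral 0 against [h], which is positive almost
   everywhere. *)
have mE : {ae mu, forall x, op m x = r * m x}.
  have bd : bmf (fun x => op m x - r * m x) by apply: bmfB => //; exact: bmfZ.
  have d0 x : 0 <= op m x - r * m x by rewrite subr_ge0 -lr; exact: modulus_le_op.
  have : \int[mu]_x ((op m x - r * m x) * h x) = 0.
    transitivity (\int[mu]_x (op m x * h x - r * (m x * h x))).
      by apply: eq_Rint => x; rewrite mulrBl mulrA.
    rewrite RintB; [|exact: bmfM|by apply: bmfZ; exact: bmfM].
    by rewrite Rint_op_right// RintZ ?subrr//; exact: bmfM.
  move=> /(Rint_eq0P mu (bmfM bd bh) (fun x => mulr_ge0 (d0 x) (h_ge0 x))) H.
  apply: filterS2 H h_gt0 => x /eqP; rewrite mulf_eq0 subr_eq0 => /orP[/eqP //|/eqP ->].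
  by rewrite ltxx.
have m_gt0 : {ae mu, forall x, 0 < m x}.
  apply: (eigenfunction_gt0 iG bm m0 mE) => H; apply: g0; apply: filterS H => x /eqP.
  by rewrite normc_eq0 => /eqP.
(* The relation between phases, cleared of denominators: it becomes the vanishing of two bounded
   functions [D1] and [D2], hence measurable. *)
pose P (y x : T) := 0 < G (y, x) -> g y * (r * m x)%:C%C = l * g x * (m y)%:C%C.
have P2 : {ae mu, forall x, {ae mu, forall y, P y x}}.
  apply: filterS2 mE m_gt0 => x mx mx0.
  have gx0 : g x != 0 by rewrite -normc_eq0 gt_eqF.
  have lg0 : l * g x != 0 by rewrite mulf_neq0.
  have := phase_transport bg gl lg0; rewrite lr => /(_ mx).
  apply: filterS => y H /H ->; rewrite -/(m y) mulrAC; congr (_ * _).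
  by rewrite -lr -[m x]/(normc (g x)) -Normc.normcM phase_mul.
have mP : measurable [set z : T * T | P z.2 z.1].
  apply: mset_imply.
    apply: (mset_comp (h := fun z : T * T => (z.2, z.1)) _ (mset_pw mu G 0)).
    exact: measurable_fun_pair.
  have [bR bI] := bg.
  pose D1 (z : T * T) := complex.Re (g z.2) * (r * m z.1) -
    (complex.Re l * complex.Re (g z.1) - complex.Im l * complex.Im (g z.1)) * m z.2.
  pose D2 (z : T * T) := complex.Im (g z.2) * (r * m z.1) -
    (complex.Re l * complex.Im (g z.1) + complex.Im l * complex.Re (g z.1)) * m z.2.
  have -> : [set z : T * T | g z.2 * (r * m z.1)%:C%C = l * g z.1 * (m z.2)%:C%C] =
      [set z | D1 z = 0 /\ D2 z = 0].
    apply/seteqP; split => -[x y] /=; rewrite /D1 /D2 /=;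
      move: (l) (g y) (g x) => [l1 l2] [a b] [a' b'] /=.
      by move=> [e1 e2]; split; lra.
    by move=> [e1 e2]; apply: complex_ext => /=; lra.
  have b1 := bmf_fst T bR; have b2 := bmf_fst T bI; have b3 := bmf_fst T bm.
  have b4 := bmf_snd T bR; have b5 := bmf_snd T bI; have b6 := bmf_snd T bm.
  apply: mset_and; apply: mset_eq0.
    have [] // : bmf D1.
    apply: bmfB; first by apply: bmfM => //; exact: bmfZ.
    by apply: bmfM => //; apply: bmfB; exact: bmfZ.
  have [] // : bmf D2.
  apply: bmfB; first by apply: bmfM => //; exact: bmfZ.
  by apply: bmfM => //; apply: bmfD; exact: bmfZ.
have P1 : {ae mu, forall y, {ae mu, forall x, P y x}}.
  exact: (@ae_swap _ _ _ _ _ mu mu (fun x y => P y x) mP P2).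
pose u x := phase (g x).
have toQ y x : 0 < m y -> 0 < m x -> P y x -> 0 < G (y, x) -> u y = (l / r%:C%C) ^+ 1 * u x.
  move=> my mx + Gyx => /(_ Gyx) E.
  have c0 (z : R) : 0 < z -> z%:C%C != 0 :> R[i].
    by move=> z0; rewrite (inj_eq (@complexI R) _ 0) gt_eqF.
  rewrite expr1 /u /phase -/(m y) -/(m x).
  apply: (mulIf (c0 _ my)); rewrite divfK ?c0//.
  apply: (mulIf (c0 _ (mulr_gt0 r0 mx))); rewrite E.
  have -> : (r * m x)%:C%C = r%:C%C * (m x)%:C%C :> R[i] by rewrite rmorphM.
  by field; rewrite !c0.
have Q1 : {ae mu, forall y, {ae mu, forall x, 0 < G (y, x) -> u y = (l / r%:C%C) ^+ 1 * u x}}.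
  apply: (filterS2 _ _ P1 m_gt0) => y Py my; apply: (filterS2 _ _ Py m_gt0) => x Pyx mx.
  exact: toQ.
have Q2 : {ae mu, forall x, {ae mu, forall y, 0 < G (y, x) -> u y = (l / r%:C%C) ^+ 1 * u x}}.
  apply: (filterS2 _ _ P2 m_gt0) => x Px mx; apply: (filterS2 _ _ Px m_gt0) => y Pyx my.
  exact: toQ.
exists u; split.
  by apply: filterS m_gt0 => x mx; rewrite -normc_eq0 normc_phase ?oner_eq0// -normc_eq0 gt_eqF.
apply: (walk_ae (Q := fun k y x => u y = (l / r%:C%C) ^+ k.+1 * u x)) => //.
by move=> k y z x -> ->; rewrite expr1 mulrA -exprSr.
Qed.

End right_perron.

End peripheral.

(** * Powers as integrals over tuples of intermediate points *)

Section power_link.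
Context d (T : measurableType d) (R : realType) (mu : probability T R).
Variable G : digraphon T R.

Definition walk_weight k (x y : T) (s : k.-tuple T) : R :=
  \prod_(i < k.+1) G (nth x (x :: s) i, nth y (rcons s y) i).

Lemma measurable_nth_tuple k (x : T) i :
  measurable_fun [set: k.-tuple T] (fun s : k.-tuple T => nth x s i).
Proof.
case: (ltnP i k) => ik; last first.
  have -> : (fun s : k.-tuple T => nth x s i) = (fun=> x).
    by apply/funext => s; rewrite nth_default// size_tuple.
  exact: measurable_cst.
have -> : (fun s : k.-tuple T => nth x s i) = (fun s => tnth s (Ordinal ik)).
  by apply/funext => s; rewrite (tnth_nth x).
exact: measurable_tnth.
Qed.


Lemma bmf_walk_weight k x y : bmf (@walk_weight k x y).
Proof.
apply: bmf01; last first.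
  move=> s; apply/andP; split; first by apply: prodr_ge0 => i _; exact: digraphon_ge0.
  by apply: prodr_ile1 => i _; exact: digraphon_bounds.
apply: measurable_prod => i _; apply: (measurableT_comp (digraphon_measurable G)).
apply: measurable_fun_pair.
  case: i => -[|i] ik /=; first exact: measurable_cst.
  exact: measurable_nth_tuple.
have -> : (fun s : k.-tuple T => nth y (rcons s y) i) = (fun s : k.-tuple T => nth y s i).
  apply/funext => s; rewrite nth_rcons; case: ltnP => // si.
  by rewrite [RHS]nth_default//; case: ifP.
exact: measurable_nth_tuple.
Qed.

Lemma walk_weight_cons k x y w (s : k.-tuple T) :
  @walk_weight k.+1 x y (tuple_cons (w, s)) = G (x, w) * @walk_weight k w y s.
Proof.
rewrite /walk_weight big_ord_recl /=; congr (_ * _); apply: eq_bigr => i _; congr (G (_, _)).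
(* The two sides differ only in the default of [nth], which is never reached. *)
by apply: set_nth_default; rewrite /= size_tuple add0n.
Qed.

Lemma Rint_walk_weight k x y :
  \int[power_measure mu k]_s (@walk_weight k x y s) = pw mu G k (x, y).
Proof.
elim: k x y => [|k IH] x y.
  under eq_Rint do rewrite /walk_weight big_ord_recl big_ord0 mulr1 /=.
  have -> : (fun s : 0.-tuple T => G (x, nth y (rcons s y) 0)) = (fun=> G (x, y)).
    by apply/funext => s; rewrite tuple0.
  by rewrite Rintegral_cst// [X in fine X](probability_setT (power_measure mu 0)) mulr1.
have bH := bmf_walk_weight k.+1 x y.
have mH : measurable_fun setT (EFin \o @walk_weight k.+1 x y).
  by apply/measurable_EFinP; case: bH.
transitivity (\int[prod_prob mu (power_measure mu k)]_z (@walk_weight k.+1 x y (tuple_cons z))).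
  rewrite /Rintegral; congr fine.
  apply: (@ge0_integral_distribution _ _ _ _ _ (prod_prob mu (power_measure mu k)) (@tuple_cons _ T k) _ mH).
  move=> s; rewrite lee_fin; apply: prodr_ge0 => i _; exact: digraphon_ge0.
rewrite Rint_prod; last first.
  by apply: (bmf_comp _ bH); exact: measurable_tuple_cons.
transitivity (\int[mu]_w (G (x, w) * pw mu G k (w, y))) => //.
apply: eq_Rint => w; rewrite -IH -RintZ; last exact: bmf_walk_weight.
by apply: eq_Rint => s; rewrite walk_weight_cons.
Qed.

Lemma digraphon_powerE k x y : digraphon_power mu G k.+1 x y = pw mu G k (x, y).
Proof. exact: Rint_walk_weight. Qed.

End power_link.

(** * Primitive roots of unity from the complex exponential *)

Section cexp_root.
Variable R : realType.

Definition uroot (n : nat) : R[i] := cexp (- ((2 * pi)%:C%C * 'i%C / n%:R)).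

Lemma urootE n : uroot n = Complex (cos (2 * pi / n%:R)) (- sin (2 * pi / n%:R)).
Proof.
rewrite /uroot; have -> : - ((2 * pi)%:C%C * 'i%C / n%:R) = Complex 0 (- (2 * pi / n%:R)) :> R[i].
  have -> : n%:R = (n%:R : R)%:C%C :> R[i] by rewrite rmorph_nat.
  rewrite -fmorphV; move: (_^-1) => v.
  by apply: complex_ext => /=; ring.
by rewrite /cexp /= expR0 cosN sinN; apply: complex_ext => /=; ring.
Qed.

Lemma urootX n k : uroot n ^+ k = Complex (cos (2 * pi / n%:R * k%:R)) (- sin (2 * pi / n%:R * k%:R)).
Proof.
elim: k => [|k IH]; first by rewrite mulr0 cos0 sin0 oppr0.
have -> : 2 * pi / n%:R * k.+1%:R = 2 * pi / n%:R + 2 * pi / n%:R * k%:R :> R.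
  by rewrite -natr1; ring.
rewrite exprS IH urootE cosD sinD.
by apply: complex_ext => /=; ring.
Qed.

(** For [0 < k < n] the number [x = pi * k / n] lies strictly between 0 and [pi], so the real part
    of the power, [cos (2 * x) = 1 - 2 * sin x ^+ 2], is less than 1. *)
Lemma uroot_primitive n : (0 < n)%N -> n.-primitive_root (uroot n).
Proof.
move=> n0; have nR : (0 : R) < n%:R by rewrite ltr0n.
apply/andP; split => //; apply/forallP => i; rewrite unity_rootE urootX; apply/eqP.
have [->|neq] := eqVneq i.+1 n.
  have -> : 2 * pi / n%:R * n%:R = pi *+ 2 :> R by rewrite divfK ?gt_eqF// mulr_natl.
  by rewrite cos2pi sin2pi oppr0; apply/eqP.
apply/negbTE/negP => /eqP[c1 _].
have ilt : (i.+1 < n)%N by rewrite ltn_neqAle neq ltn_ord.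
pose x : R := pi / n%:R * i.+1%:R.
have e : 2 * pi / n%:R * i.+1%:R = x *+ 2 by rewrite /x mulr2n; ring.
have x0 : 0 < sin x.
  apply: sin_gt0_pi; rewrite /x mulr_gt0 ?divr_gt0 ?pi_gt0 ?ltr0n//=.
  by rewrite mulrAC ltr_pdivrMr// ltr_pM2l ?pi_gt0// ltr_nat.
move: c1; rewrite e cos_mulr2n; have := cos2Dsin2 x; have := mulr_gt0 x0 x0.
by rewrite mulr2n !expr2; lra.
Qed.

End cexp_root.

Lemma ae_prod2 d1 d2 (T1 : measurableType d1) (T2 : measurableType d2) (R : realType)
  (m1 : probability T1 R) (m2 : probability T2 R) (P : T1 * T2 -> Prop) :
  {ae prod_prob m1 m2, forall z, P z} -> {ae m2, forall y, {ae m1, forall x, P (x, y)}}.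
Proof.
move=> [N [mN N0 PN]].
have aeN : {ae prod_prob m1 m2, forall z, ~ N z} by exists N; split => // z /= /contrapT.
have := @ae_swap _ _ _ _ _ m1 m2 (fun x y => ~ N (x, y)) _ (ae_prod aeN).
move=> H; have {}H := H _.
apply: filterS (H _) => [y|].
  by apply: filterS => x nN; apply: contrapT => nP; apply: nN; exact: PN.
have := measurableC mN; congr measurable; apply/seteqP; by split => -[].
Qed.

(** * Eigenvalues from cyclic partitions *)

Section cyclic_eigenvalues.
Context d (T : measurableType d) (R : realType) (mu : probability T R).
Variable G : digraphon T R.
Local Notation op := (lop mu G).
Local Notation opc := (digraphon_op mu G).
Let bG := bmf_digraphon G.

Lemma partition_index n (P : 'I_n -> set T) : (forall j, measurable (P j)) ->
  partition [set: 'I_n] P [set: T] -> exists c : T -> nat,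
  [/\ forall x, (c x < n)%N, forall x (j : 'I_n), P j x <-> c x = j &
      forall k, measurable [set x | c x = k]].
Proof.
move=> mP [cov triv _].
have /choice[i iP] : forall x, exists j : 'I_n, P j x.
  move=> x; have : cover [set: 'I_n] P x by rewrite cov.
  by move=> [j _ Pj]; exists j.
have iE x (j : 'I_n) : P j x <-> i x = j :> nat.
  split; last by move=> /val_inj <-.
  by move=> Pj; rewrite (triv (i x) j)//; exists x.
exists (fun x => i x); split => //.
move=> k; case: (ltnP k n) => kn; last first.
  rewrite (_ : [set x | _] = set0)//; apply/seteqP; split => // x /= e.
  by have := ltn_ord (i x); rewrite e ltnNge kn.
have := mP (Ordinal kn); congr measurable; apply/seteqP.
by split => x /=; rewrite iE.
Qed.

Lemma cyclic_sets_step n (P : 'I_n -> set T) (c : T -> nat) : cyclic_sets mu G P ->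
  (forall x, (c x < n)%N) -> (forall x (j : 'I_n), P j x <-> c x = j) ->
  {ae prod_prob mu mu, forall z, G z != 0 -> c z.2 = (c z.1).+1 %[mod n]}.
Proof.
move=> [_ _ PG] cn cP.
(* Quantifying over [nat] together with a proof of [k < n] brings the finite family under
   [ae_foralln]. *)
have : {ae prod_prob mu mu, forall z, forall k (kn : (k < n)%N),
   (P (Ordinal kn) `*` ~` P (ordS (Ordinal kn))) z -> G z = 0}.
  apply: ae_foralln => k; have [kn|nkn] := pselect (k < n)%N; last exact: aeW.
  by apply: filterS (PG (Ordinal kn)) => z H kn'; rewrite (bool_irrelevance kn' kn).
apply: filterS => z H G0.
have [zc|zc] := pselect (P (ordS (Ordinal (cn z.1))) z.2).
  by move/cP : zc => -> /=; rewrite modn_mod.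
move: G0; rewrite (H _ (cn z.1)) ?eqxx//; split => //=.
by apply/cP.
Qed.

Section twisted.
Variables (n : nat) (c : T -> nat) (w : R[i]) (f : T -> R) (r : R).
Hypotheses (cn : forall x, (c x < n)%N) (mc : forall k, measurable [set x | c x = k]).
Hypothesis step : {ae prod_prob mu mu, forall z, G z != 0 -> c z.2 = (c z.1).+1 %[mod n]}.
Hypotheses (wn : w ^+ n = 1) (bf : bmf f) (f_gt0 : {ae mu, forall x, 0 < f x}).
Hypothesis fr : forall x, op f x = r * f x.

Lemma bmf_index (F : nat -> R) : bmf (fun x => F (c x) * f x).
Proof.
have -> : (fun x => F (c x) * f x) =
    (fun x => \sum_(i < n) F i * (\1_[set y | c y = i] x * f x)).
  apply/funext => x; rewrite (bigD1 (Ordinal (cn x)))//= big1 ?addr0.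
    by rewrite indicE mem_set// mul1r.
  move=> i ix; rewrite indicE memNset ?mul0r ?mulr0//= => e.
  by move/eqP: ix; apply; apply: val_inj.
apply: (@bmf_sum _ _ _ n (fun i x => F i * (\1_[set y | c y = i] x * f x))) => i.
by apply: bmfZ; apply: bmfM => //; exact: bmf_indic.
Qed.

Let w0 : w != 0.
Proof.
apply/eqP => w0; have n0 : (0 < n)%N by exact: leq_ltn_trans (cn point).
by move/eqP: wn; rewrite w0 expr0n gtn_eqF// eq_sym oner_eq0.
Qed.

(** The eigenfunction is [w ^- c * f]. Almost all in-neighbours of [x] lie in the preceding class,
    where the twist is [w] times the twist at [x], so this factor comes out of the integral; [wn]
    makes it consistent from the last class to the first. *)
Lemma twisted_eigenvalue : is_eigenvalue mu G (w * r%:C%C).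
Proof.
pose g x : R[i] := (w^-1) ^+ c x * (f x)%:C%C.
have wVn : w^-1 ^+ n = 1 by rewrite exprVn wn invr1.
have gRe x : complex.Re (g x) = complex.Re ((w^-1) ^+ c x) * f x.
  by rewrite /g Re_mulc /= mulr0 subr0.
have gIm x : complex.Im (g x) = complex.Im ((w^-1) ^+ c x) * f x.
  by rewrite /g Im_mulc /= mulr0 add0r.
have bgR : bmf (fun x => complex.Re (g x)).
  under eq_fun do rewrite gRe; exact: (bmf_index (fun k => complex.Re ((w^-1) ^+ k))).
have bgI : bmf (fun x => complex.Im (g x)).
  under eq_fun do rewrite gIm; exact: (bmf_index (fun k => complex.Im ((w^-1) ^+ k))).
exists g; split.
- by apply: bmf_cL2; split.
- move=> g0; have [x [/= gx fx]] := prob_ae_ex (filterI g0 f_gt0).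
  move/eqP: gx; rewrite /g mulf_eq0 expf_eq0 invr_eq0 (negbTE w0) andbF/=.
  by rewrite (inj_eq (@complexI R) _ 0) gt_eqF.
- apply: filterS (ae_prod2 step) => x Hx.
  pose k := w * (w^-1) ^+ c x.
  have wE y : c x = (c y).+1 %[mod n] -> (w^-1) ^+ c y = k.
    move=> e; rewrite /k -(expr_mod (c x) wVn) e (expr_mod _ wVn) exprS mulrA mulfV// mul1r.
    by [].
  have opE : opc g x = k * (op f x)%:C%C.
    have mG : measurable_fun setT (fun y => G (y, x)) by case: (bmf_pair2 x bG).
    have mf : measurable_fun setT (fun y => f y * G (y, x)) by case: (bmf_lop_integrand x bG bf).
    have mR : measurable_fun setT (fun y => complex.Re (g y) * G (y, x)) by case: (bmf_lop_integrand x bG bgR).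
    have mI : measurable_fun setT (fun y => complex.Im (g y) * G (y, x)) by case: (bmf_lop_integrand x bG bgI).
    have ZE (a : R) : \int[mu]_y (a * (f y * G (y, x))) = a * op f x.
      by rewrite RintZ//; exact: bmf_lop_integrand.
    apply: complex_ext.
      rewrite Re_opc Re_mulc /= mulr0 subr0 -ZE; apply: ae_eq_Rint => //.
        exact: measurable_funM.
      apply: filterS Hx => y Hy; have [->|Gy] := eqVneq (G (y, x)) 0; first by rewrite !mulr0.
      by rewrite gRe wE ?mulrA//; exact: Hy.
    rewrite Im_opc Im_mulc /= mulr0 add0r -ZE; apply: ae_eq_Rint => //.
      exact: measurable_funM.
    apply: filterS Hx => y Hy; have [->|Gy] := eqVneq (G (y, x)) 0; first by rewrite !mulr0.
    by rewrite gIm wE ?mulrA//; exact: Hy.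
  rewrite opE fr /k /g rmorphM /=; ring.
Qed.

End twisted.

Lemma cyclic_sets_eigenvalue n (P : 'I_n -> set T) (w : R[i]) (f : T -> R) (r : R) :
  cyclic_sets mu G P -> w ^+ n = 1 -> bmf f -> {ae mu, forall x, 0 < f x} ->
  (forall x, op f x = r * f x) -> is_eigenvalue mu G (w * r%:C%C).
Proof.
move=> cyc wn bf f0 fr; have [mP parP _] := cyc.
have [c [cn cP mc]] := partition_index mP parP.
exact: (twisted_eigenvalue cn mc (cyclic_sets_step cyc cn cP) wn bf f0 fr).
Qed.

End cyclic_eigenvalues.

(** * Residue classes as cyclic sets *)

Section main.
Context d (T : measurableType d) (R : realType) (mu : probability T R).
Variable G : digraphon T R.
Hypotheses (Hmu : atomless mu) (iG : irreducible mu G).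
Local Notation op := (lop mu G).
Local Notation normc := (@Normc.normc R).
Local Notation pw := (pw mu G).

(** The transpose has its own Perron eigenvalue [r']; evaluating the integral of [op f * h] through
    [f] and through [h] gives [r = r']. *)
Lemma right_perron (r : R) (f : T -> R) : 0 < r -> bmf f -> (forall x, 0 <= f x) ->
  {ae mu, forall x, 0 < f x} -> (forall x, op f x = r * f x) ->
  exists h : T -> R, [/\ bmf h, forall x, 0 <= h x, {ae mu, forall x, 0 < h x} &
    forall y, \int[mu]_x (G (y, x) * h x) = r * h y].
Proof.
move=> r0 bf f0 fpos fr.
have [r' [h [r'0 bh h0 hr hpos]]] := perron (irreducible_transpose iG) Hmu.
have hr' y : \int[mu]_x (G (y, x) * h x) = r' * h y.
  by rewrite -hr; apply: eq_Rint => x; rewrite mulrC.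
suff -> : r = r' by exists h.
have I0 : 0 < \int[mu]_x (f x * h x).
  apply: (Rint_right_gt0 bh h0 hpos bf f0) => H.
  by have [x [/= -> ]] := prob_ae_ex (filterI H fpos); rewrite ltxx.
have := Rint_op_right bh hr' bf.
under eq_Rint do rewrite fr -mulrA.
rewrite RintZ; last exact: bmfM.
by move=> /(mulIf (lt0r_neq0 I0)).
Qed.

Section period_partition.
Variables (p : nat) (c : T -> nat).
Hypotheses (p0 : (0 < p)%N) (mc : forall j, measurable [set x | (c x %% p)%N = j]).
Hypothesis edge : {ae mu, forall x, {ae mu, forall y, 0 < G (x, y) -> c y = (c x).+1 %[mod p]}}.

Definition residue_set (j : 'I_p) : set T := [set x | (c x %% p)%N = j].

(** A [partition] has nonempty classes. Starting from a generic point, positive outdegree allows a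
    generic successor to be chosen again and again, and each edge raises the residue by one. *)
Lemma residue_nonempty (j : 'I_p) : residue_set j !=set0.
Proof.
have outd := outdegree_gt0 Hmu iG.

have [x0 good0] := prob_ae_ex (filterI outd edge).
have chain n : exists x, [/\ 0 < \int[mu]_y G (x, y),
    {ae mu, forall y, 0 < G (x, y) -> c y = (c x).+1 %[mod p]} & c x = (c x0 + n)%N %[mod p]].
  elim: n => [|n [x [ox ex cx]]]; first by exists x0; case: good0 => *; split => //; rewrite addn0.
  have /Rint_gt0P : 0 < \int[mu]_y G (x, y) by [].
  move=> /(_ (bmf_pair _ (bmf_digraphon G)) (fun=> digraphon_ge0 _ _)) nG.
  have nG' : ~ {ae mu, forall y, ~ 0 < G (x, y)}.
    move=> H; apply: nG; apply: filterS H => y /negP; rewrite lt_def digraphon_ge0 andbT negbK.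
    by move/eqP.
  have [y [Gxy [[/= oy ey] cy]]] := not_ae_ex nG' (filterI (filterI outd edge) ex).
  exists y; split => //; rewrite (cy Gxy) addnS -[in RHS]addn1 -[in LHS]addn1.
  by rewrite -modnDml cx modnDml.
(* Modulo [p], the summand [p.-1 * c x0] cancels [c x0] without a subtraction. *)
have [x [_ _ cx]] := chain (j + p.-1 * c x0)%N.
exists x; rewrite /residue_set /= cx.
have -> : (c x0 + (j + p.-1 * c x0) = c x0 * p + j)%N.
  by rewrite addnCA -mulSn prednK// addnC mulnC.
by rewrite modnMDl modn_small.
Qed.

Lemma residue_cyclic_sets : cyclic_sets mu G residue_set.
Proof.
split; first by move=> j; exact: mc.
  split; last by move=> j _; exact: residue_nonempty.
    apply/seteqP; split => // x _; exists (Ordinal (ltn_pmod (c x) p0)) => //.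
  by move=> i j _ _ [x [xi xj]]; apply: val_inj; exact: etrans (esym xi) xj.
move=> j; apply: (@prod_ae _ _ _ _ _ mu mu).
  apply: mset_imply; last by apply: mset_eq0; exact: digraphon_measurable.
  by apply: measurableX; [exact: mc|apply: measurableC; exact: mc].
apply: filterS edge => x; apply: filterS => y H [/= xj yj].
apply/eqP/negP => /negP G0; apply: yj; rewrite /residue_set /= H; last by rewrite lt_def G0 digraphon_ge0.
by rewrite -addn1 -modnDml xj addn1.
Qed.

End period_partition.
End main.

Lemma eventually_periodic_intro (S : set nat) (p i j : nat) :
  (i < p)%N -> (j < p)%N -> (forall n, S n -> (i + n = j %[mod p])%N) ->
  (exists M, forall n, (M <= n)%N -> (i + n = j %[mod p])%N -> S n) ->
  eventually_periodic S p (j%:Z - i%:Z).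
Proof.
move=> ip jp Smod [M SM].
have S'sub : [set n%:Z - (j%:Z - i%:Z) | n in S] `<=` [set p%:Z * q | q in [set: int]].
  move=> _ [n Sn <-]; exists ((i + n) %/ p)%N%:Z => //.
  have := divn_eq (i + n) p; rewrite (Smod _ Sn) modn_small//.
  by rewrite mulnC; move: (_ %/ _)%N => q; lia.
(* The summand [p] absorbs the shift: for [p * q] above [M + p], the length [p * q + j - i] is still
   at least [M]. *)
split => //; exists (M + p).+1 => //; apply/seteqP; split => m /= [Sm Km]; split => //.
  have [q _ qm] := S'sub _ Sm.
  have q0 : 0 < q.
    rewrite ltNge; apply/negP => q0.
    have : p%:Z * q <= 0 by rewrite pmulr_rle0// ltz_nat (leq_ltn_trans _ ip).
    by rewrite qm; lia.
  by exists `|q|%N; rewrite /= ?absz_gt0 ?gt_eqF// gez0_abs ?ltW.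
case: Sm => q q0 qm.
have pq : (M + p < p * q)%N by move: Km; rewrite -qm; lia.
exists (p * q + j - i)%N; last by rewrite -qm; lia.
apply: SM; first by lia.
rewrite (_ : (i + _ = q * p + j)%N); last by rewrite mulnC; lia.
by rewrite modnMDl.
Qed.

(** * Identification of the peripheral spectrum *)

Section conclusion.
Context d (T : measurableType d) (R : realType) (mu : probability T R).
Variable G : digraphon T R.
Hypotheses (Hmu : atomless mu) (HG : strongly_connected mu G).
Local Notation op := (lop mu G).
Local Notation normc := (@Normc.normc R).
Local Notation pw := (pw mu G).

Let iG : irreducible mu G. Proof. exact: strongly_connected_irreducible. Qed.

Section period.
Variables (p : nat) (c : T -> nat).
Hypotheses (p0 : (0 < p)%N) (mc : forall j, measurable [set x | (c x %% p)%N = j]).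
Hypothesis edge : {ae mu, forall x, {ae mu, forall y, 0 < G (x, y) -> c y = (c x).+1 %[mod p]}}.
Hypothesis walk : {ae mu, forall x, {ae mu, forall y, forall k,
    0 < pw k (x, y) -> c y = (c x + k.+1)%N %[mod p]}}.
Hypothesis late : {ae mu, forall x, {ae mu, forall y, exists M, forall k, (M <= k)%N ->
    c y = (c x + k.+1)%N %[mod p] -> 0 < pw k (x, y)}}.

Lemma residue_reachability (i j : 'I_p) : {ae prod_prob mu mu, forall z : T * T,
  (residue_set c i `*` residue_set c j) z ->
  eventually_periodic (reachability_sequence mu G z.1 z.2) p ((j : nat)%:Z - (i : nat)%:Z)}.
Proof.
have mmod k : measurable [set z : T * T | (c z.2 = c z.1 + k.+1 %[mod p])%N].
  have -> : [set z : T * T | (c z.2 = c z.1 + k.+1 %[mod p])%N] =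
      [set z | exists a, (c z.1 %% p)%N = a /\ (c z.2 %% p)%N = ((a + k.+1) %% p)%N].
    apply/seteqP; split => z /=; first by move=> e; exists (c z.1 %% p)%N; rewrite modnDml.
    by move=> [a [<- ->]]; rewrite modnDml.
  apply: mset_exists => a; apply: mset_and.
    exact: (mset_comp measurable_fst (mc a)).
  exact: (mset_comp measurable_snd (mc _)).
have walk2 : {ae prod_prob mu mu, forall z : T * T, forall k,
    0 < pw k z -> (c z.2 = c z.1 + k.+1 %[mod p])%N}.
  apply: prod_ae; last exact: walk.
  apply: mset_forall => k; apply: mset_imply => //; exact: mset_pw.
have late2 : {ae prod_prob mu mu, forall z : T * T, exists M, forall k, (M <= k)%N ->
    (c z.2 = c z.1 + k.+1 %[mod p])%N -> 0 < pw k z}.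
  apply: prod_ae; last exact: late.
  apply: mset_exists => M; apply: mset_forall => k; apply: mset_imply; first exact: mset_cst.
  by apply: mset_imply => //; exact: mset_pw.
apply: filterS2 walk2 late2 => -[x y] /= walkxy [M latexy] [/= cx cy].
rewrite /residue_set /= in cx cy.
apply: eventually_periodic_intro => //.
  move=> [[]//|n] [_]; rewrite digraphon_powerE => /walkxy e.
  by rewrite -cx modnDml -e cy modn_small.
exists M.+1 => -[//|n] Mn e; split => //; rewrite digraphon_powerE; apply: latexy => //.
by rewrite -modnDml cx e cy modn_small.
Qed.

Lemma peripheral_root_of_unity (r : R) (l : R[i]) (u : T -> R[i]) : 0 < r -> l != 0 ->
  {ae mu, forall x, u x != 0} ->
  {ae mu, forall y, {ae mu, forall x, forall k, 0 < pw k (y, x) ->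
     u y = (l / r%:C%C) ^+ k.+1 * u x}} -> (l / r%:C%C) ^+ p = 1.
Proof.
move=> r0 l0 u0 uE; set th := l / r%:C%C.
have th0 : th != 0.
  by rewrite mulf_neq0// invr_eq0 (inj_eq (@complexI R) _ 0) gt_eqF.
have [x [/= ux lx]] := prob_ae_ex (filterI uE late).
have [y [/= [uxy ly] uy]] := prob_ae_ex (filterI (filterI ux lx) u0).
have [M HM] := ly.
(* The length [k.+1] has the residue [c y - c x]; the added multiple of [p] makes the subtraction
   exact and [k] at least [M], so that [k] and [k + p] both occur. *)
pose k := ((c y + (M + c x + 1) * p) - c x).-1.
have Mp : (M + c x + 1 <= (M + c x + 1) * p)%N by rewrite leq_pmulr.
have k1 : (k.+1 = c y + (M + c x + 1) * p - c x)%N by rewrite /k; lia.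
have Mk : (M <= k)%N by rewrite -ltnS k1; lia.
have ck : (c y = c x + k.+1 %[mod p])%N.
  rewrite k1 subnKC; last by lia.
  by rewrite addnC modnMDl.
have ckp : (c y = c x + (k + p).+1 %[mod p])%N.
  by rewrite -addSn addnA modnDr.
have e1 := uxy _ (HM _ Mk ck).
have e2 := uxy _ (HM _ (leq_trans Mk (leq_addr _ _)) ckp).
move: e2; rewrite e1 -addSn exprD => /(mulIf uy).
by rewrite -[LHS]mulr1 => /(mulfI (expf_neq0 _ th0)).
Qed.

End period.

(** The eigenfunction [f] is kept in the statement because (i) twists it along an arbitrary cyclic
    partition, which need not be the one by residues modulo [p]. *)
Lemma spectral_picture : exists (p : nat) (c : T -> nat) (r : R) (f : T -> R),
  [/\ (0 < p)%N /\ 0 < r,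
      cyclic_sets mu G (residue_set (p := p) c),
      forall i j : 'I_p, {ae prod_prob mu mu, forall z : T * T,
        (residue_set c i `*` residue_set c j) z ->
        eventually_periodic (reachability_sequence mu G z.1 z.2) p ((j : nat)%:Z - (i : nat)%:Z)},
      [/\ bmf f, {ae mu, forall x, 0 < f x} & forall x, op f x = r * f x] &
      forall l, is_eigenvalue mu G l ->
        normc l <= r /\ (normc l = r -> (l / r%:C%C) ^+ p = 1)].
Proof.
have [p [c [p0 mc edge walk late]]] := period_exists Hmu iG.
have [r [f [r0 bf f0 fr fpos]]] := perron iG Hmu.
have [h [bh h0 hpos hr]] := right_perron Hmu iG r0 bf f0 fpos fr.
exists p, c, r, f; split => //.
- exact: residue_cyclic_sets.
- by move=> i j; exact: residue_reachability.
- move=> l el; split; first by apply: (eigenvalue_le bh h0 hpos hr) => //; exact: ltW.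
  move=> lr.
  have [u [u0 uE]] := peripheral_phase iG bh h0 hpos hr r0 el lr.
  apply: (peripheral_root_of_unity p0 late r0 _ u0 uE).
  by rewrite -normc_eq0 lr gt_eqF.
Qed.

(** Since [fset_set] is informative on finite sets only, [A] is exhibited as a duplicate-free list
    of the [p] products of [r] with the powers of [w]. *)
Lemma card_roots (p : nat) (w : R[i]) (r : R) (A : set R[i]) : (0 < p)%N -> 0 < r ->
  p.-primitive_root w -> A = [set l | (l / r%:C%C) ^+ p = 1] -> #|` fset_set A|%fset = p.
Proof.
move=> p0 r0 wp AE.
have rC0 : r%:C%C != 0 :> R[i] by rewrite (inj_eq (@complexI R) _ 0) gt_eqF.
pose s := [seq w ^+ i * r%:C%C | i <- iota 0 p].
have us : uniq s.
  rewrite map_inj_in_uniq ?iota_uniq// => i j; rewrite !mem_iota /= !add0n => ip jp.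
  move/(mulIf rC0)/eqP; rewrite (eq_prim_root_expr wp).
  by rewrite !modn_small// => /eqP.
have -> : A = [set` [fset x in s]%fset].
  apply/seteqP; split => l /=; rewrite !inE AE /=.
    move=> lp; have [i li] := prim_rootP wp lp.
    by apply/mapP; exists (i : nat); rewrite ?mem_iota ?ltn_ord// -li divfK.
  move=> /mapP[i _ ->]; rewrite mulfK// exprAC (prim_expr_order wp) expr1n //.
by rewrite set_fsetK card_fseq undup_id// size_map size_iota.
Qed.

End conclusion.

Theorem theorem6p2 (disp : measure_display) (T : measurableType disp)
    (R : realType) (mu : probability T R) (Hmu : atomless mu)
    (G : digraphon T R) (HG : strongly_connected mu G) :
  let D := peripheral_multiplicity mu G in
  (forall d : nat, (0 < d)%N -> graphically_periodic mu G d ->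
     is_eigenvalue mu G
       (cexp (- ((2 * pi)%:C%C * 'i%C / d%:R)) * (spectral_radius mu G)%:C%C)
     /\ (d %| D)%N) /\
  (graphically_periodic mu G D /\
   exists P : 'I_D -> set T,
     cyclic_sets mu G P /\
     forall i j : 'I_D, {ae (mu \x mu)%E, forall z : T * T,
       (P i `*` P j) z ->
       eventually_periodic (reachability_sequence mu G z.1 z.2) D
         ((j : nat)%:Z - (i : nat)%:Z)}).
Proof.
have [p [c [r [f [[p0 r0] cyc reach [bf fpos fr] specG]]]]] := spectral_picture Hmu HG.
have le_r l : is_eigenvalue mu G l -> Normc.normc l <= r by move=> /specG[].
have per l : is_eigenvalue mu G l -> Normc.normc l = r -> (l / r%:C%C) ^+ p = 1.
  by move=> /specG[].
have twist n (P : 'I_n -> set T) w : cyclic_sets mu G P -> w ^+ n = 1 ->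
    is_eigenvalue mu G (w * r%:C%C).
  by move=> cP wn; exact: (cyclic_sets_eigenvalue cP wn bf fpos fr).
have rC0 : r%:C%C != 0 :> R[i] by rewrite (inj_eq (@complexI R) _ 0) gt_eqF.
(* Twisting by [w = 1] shows that the upper bound [r] is attained by an eigenvalue. *)
have er : is_eigenvalue mu G r%:C%C.
  by rewrite -[r%:C%C]mul1r; apply: (twist _ _ _ cyc); rewrite expr1n.
have rho : spectral_radius mu G = r.
  apply/eqP; rewrite eq_le; apply/andP; split.
    by apply: ge_sup; [exists r, r%:C%C => //; exact: normcR (ltW r0)|move=> _ [l el <-]; exact: le_r].
  apply: ub_le_sup; first by exists r => _ [l el <-]; exact: le_r.
  by exists r%:C%C => //; exact: normcR (ltW r0).
have norm_root n (w : R[i]) : (0 < n)%N -> w ^+ n = 1 -> Normc.normc (w * r%:C%C) = r.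
  move=> n0 wn; rewrite Normc.normcM normcR ?(ltW r0)//.
  suff -> : Normc.normc w = 1 by rewrite mul1r.
  apply/eqP; rewrite -(@eqrXn2 _ n) ?ler01 ?normc_ge0// expr1n -normcX wn.
  by apply/eqP; exact: Normc.normc1.
have periE : peripheral_eigenvalues mu G = [set l | (l / r%:C%C) ^+ p = 1].
  apply/seteqP; split => l; rewrite /peripheral_eigenvalues /= rho.
    by move=> [el lr]; exact: per.
  move=> lp; rewrite -(divfK rC0 l); split; first exact: (twist _ _ _ cyc).
  exact: norm_root lp.
have DE : peripheral_multiplicity mu G = p.
  exact: (card_roots p0 r0 (uroot_primitive R p0) periE).
move=> D; rewrite {}/D DE rho; split; last first.
  by split; [split => //; exists (residue_set c)|exists (residue_set c)].
move=> n n0 [_ [P cP]]; have wn := uroot_primitive R n0.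
have ew := twist _ _ _ cP (prim_expr_order wn); split => //.
(* The eigenvalue [w * r] is peripheral, so [w ^+ p = 1], and the order [n] of [w] divides [p]. *)
have := per _ ew (norm_root _ _ n0 (prim_expr_order wn)).
by rewrite mulfK// => /eqP; rewrite -(prim_order_dvd wn).
Qed.
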